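(* Let $(X,|\cdot|_X)$ and $(Y,|\cdot|_Y)$ be real Banach spaces and let $f:X\to Y$ be a local $C^1$-diffeomorphism. Let $y\in Y$. Suppose that the locally Lipschitz functional $F_y:X\to\mathbb{R}$, $F_y(x)=\frac12|f(x)-y|_Y^2$, satisfies the weighted Chang Palais-Smale condition for some continuous nondecreasing function $h:[0,+\infty)\to[0,+\infty)$ such that $\int_0^\infty\frac{1}{1+h(\rho)}\,d\rho=+\infty$. Then there is a unique $x\in X$ such that $f(x)=y$.
   Context: A map $f:X\to Y$ is a local $C^1$-diffeomorphism if it is $C^1$ and $df(x)$ is a linear isomorphism of $X$ onto $Y$ for every $x\in X$. For a locally Lipschitz functional $F:X\to\mathbb{R}$ on a real Banach space $X$ with dual $X^*$, the generalized directional derivative is $F^0(x;v)=\limsup_{z\to 0,\ t\downarrow 0}\frac1t\left(F(x+z+tv)-F(x+z)\right)$, the Clarke generalized gradient is $\partial F(x)=\{w^*\in X^*: \langle w^*,v\rangle\le F^0(x;v)\ \forall v\in X\}$ (a nonempty convex weak*-compact set), and $\lambda_F(x)=\min_{w^*\in\partial F(x)}|w^*|_{X^*}$. Given $h$, the functional $F$ satisfies the weighted Chang Palais-Smale condition for $h$ if any sequence $\{x_n\}$ in $X$ such that $\{F(x_n)\}$ is bounded and $\lim_{n\to\infty}\lambda_F(x_n)(1+h(|x_n|_X))=0$ contains a norm-convergent subsequence. *)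

(* Defs.v *)
From HB Require Import structures.
From mathcomp Require Import all_boot all_order all_algebra.
From mathcomp Require Import all_classical all_reals all_analysis.

Set Implicit Arguments.
Unset Strict Implicit.
Unset Printing Implicit Defensive.

Import Order.TTheory GRing.Theory Num.Theory.
Import numFieldNormedType.Exports.

Local Open Scope classical_set_scope.
Local Open Scope ring_scope.

(* The supremum is a genuine one for bounded linear maps; only such maps are
   used below. With W := R^o this is the norm of the dual space. *)
Definition opnorm (R : realType) (V W : normedModType R) (L : V -> W) : R :=
  sup [set `|L v| | v in [set v : V | `|v| <= 1]].

(* C^1 means that the differential is continuous as a map from V to the bounded
   linear operators equipped with the operator norm. *)
Definition C1 (R : realType) (V W : normedModType R) (f : V -> W) : Prop :=
  (forall x, differentiable f x) /\
  (forall x, opnorm (fun v => 'd f z v - 'd f x v) @[z --> x] --> (0 : R)).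

(* For differentiable f the library's ['d f x] is linear and continuous, so
   only bijectivity has to be required. *)
Definition local_C1_diffeo (R : realType) (V W : normedModType R)
    (f : V -> W) : Prop :=
  C1 f /\ forall x, bijective ('d f x).

(* The filter on pairs (z, t) is that of z --> 0 (z = 0 allowed) jointly with
   t --> 0, t > 0. The value is finite when F is locally Lipschitz. *)
Definition clarke_dd (R : realType) (V : normedModType R) (F : V -> R)
    (x v : V) : \bar R :=
  limf_esup
    (fun p : V * R => (p.2^-1 * (F (x + p.1 + p.2 *: v) - F (x + p.1)))%:E)
    (filter_prod (nbhs (0 : V)) (0 : R)^'+).

Definition clarke_gradient (R : realType) (V : normedModType R) (F : V -> R)
    (x : V) : set {linear V -> R^o} :=
  [set w : {linear V -> R^o} | continuous w /\
     forall v, ((w v : R)%:E <= clarke_dd F x v)%E].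

(* For locally Lipschitz F the set of norms is nonempty and, by weak*
   compactness of the gradient, its infimum is a minimum. *)
Definition clarke_lambda (R : realType) (V : normedModType R) (F : V -> R)
    (x : V) : R :=
  inf [set opnorm w | w in clarke_gradient F x].

Definition weighted_chang_PS (R : realType) (V : normedModType R) (F : V -> R)
    (h : R -> R) : Prop :=
  forall u : nat -> V,
    bounded_fun (F \o u) ->
    clarke_lambda F (u n) * (1 + h `|u n|) @[n --> \oo] --> (0 : R) ->
    exists2 phi : nat -> nat, increasing_seq phi & cvgn (u \o phi).

(* Only the values of h on [0, +oo[ matter. *)
Definition admissible_weight (R : realType) (h : R -> R) : Prop :=
  [/\ {within `[0, +oo[, continuous h},
      {in `[0, +oo[ &, {homo h : r s / r <= s}},
      forall r, 0 <= r -> 0 <= h r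
    & (\int[lebesgue_measure]_(r in `[0%R, +oo[) ((1 + h r)^-1)%:E = +oo)%E].

Definition dist_functional (R : realType) (V W : normedModType R) (f : V -> W)
    (y : W) (x : V) : R :=
  2^-1 * `|f x - y| ^+ 2.

(* Main.v *)
Require Import Defs.
From HB Require Import structures.
From mathcomp Require Import all_boot all_order all_algebra.
From mathcomp Require Import all_classical all_reals all_analysis.
From mathcomp Require Import measurable_realfun ring lra.

Set Implicit Arguments.
Unset Strict Implicit.
Unset Printing Implicit Defensive.

Import Order.TTheory GRing.Theory Num.Theory.
Import numFieldNormedType.Exports.

Local Open Scope classical_set_scope.
Local Open Scope ring_scope.

(** Let [F = |f - y|^2 / 2]. At a point where [f x <> y] the direction solving
    ['d f x v = y - f x] decreases [F] at a definite rate near [x], so limits of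
    almost critical sequences are solutions. Such sequences come from one
    minimax argument: apply Ekeland's principle, with the step at a map [g]
    weighted by [1 + h (sup |g|)], to [g |-> sup F o g] on a family of maps into
    [X]; divergence of the integral of [1 / (1 + h)] keeps the greedy sequence
    bounded. If no maximum point of [F o g] were almost critical, gluing finitely
    many descent directions along the compact range of [g] would contradict
    minimality. By Hahn-Banach, absence of a steep descent direction bounds
    [clarke_lambda], so the Palais-Smale condition applies. Maps from a point
    give existence. For uniqueness, two solutions are separated by a sphere on
    which [F] is bounded below, [f] being a strict local expansion up to a
    factor, so paths joining them would give a solution at a positive level. *)

(** * Hahn-Banach *)

Section HahnBanach.
Variables (R : realType) (V : lmodType R).

Definition sublinear (q : V -> R) :=
  (forall u v, q (u + v) <= q u + q v) /\
  (forall (t : R) v, 0 <= t -> q (t *: v) <= t * q v).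

Lemma sublinear0 q : sublinear q -> q 0 = 0.
Proof.
move=> [qD qZ]; apply/eqP; rewrite eq_le.
have := qZ 0 0 (lexx 0); rewrite scale0r mul0r => ->.
by have := qD 0 0; rewrite addr0 -subr_ge0 addrK.
Qed.

Lemma sublinearZ q (t : R) v : sublinear q -> 0 <= t -> q (t *: v) = t * q v.
Proof.
move=> sq; rewrite le_eqVlt => /orP[/eqP <-|t0].
  by rewrite scale0r mul0r sublinear0.
have [_ qZ] := sq.
apply/eqP; rewrite eq_le (qZ _ _ (ltW t0))/=.
have ti0 : 0 <= t^-1 by rewrite invr_ge0 ltW.
have := qZ t^-1 (t *: v) ti0; rewrite scalerA mulVf ?gt_eqF// scale1r.
by rewrite ler_pdivlMl.
Qed.

Lemma sublinear_geN q v : sublinear q -> - q (- v) <= q v.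
Proof.
move=> sq; have := sq.1 v (- v); rewrite subrr sublinear0// => ?; lra.
Qed.

(** The common source of every sublinear function built below. Sums and positive multiples need only
    be dominated by another member of the family, and [p] keeps the infima finite. *)
Lemma sublinear_inf (I : Type) (A : set I) (q : I -> V -> R) (p : V -> R) :
  A !=set0 ->
  (forall i v, A i -> p v <= q i v) ->
  (forall i j u v, A i -> A j ->
     exists2 k, A k & q k (u + v) <= q i u + q j v) ->
  (forall i (t : R) v, A i -> 0 < t ->
     exists2 k, A k & q k (t *: v) <= t * q i v) ->
  (exists2 i, A i & q i 0 <= 0) ->
  sublinear (fun v => inf [set q i v | i in A]) /\
  forall i v, A i -> inf [set q i v | i in A] <= q i v.
Proof.
move=> A0 pq qD qZ q0.
have lbq i v : A i -> inf [set q i v | i in A] <= q i v.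
  move=> Ai; apply: ge_inf; last by exists i.
  by exists (p v) => _ [j Aj <-]; exact: pq.
have geq (v : V) (x : R) : (forall i, A i -> x <= q i v) ->
    x <= inf [set q i v | i in A].
  move=> h; apply: lb_le_inf; first by case: A0 => i Ai; exists (q i v), i.
  by move=> _ [i Ai <-]; exact: h.
split=> //; split=> [u v|t v].
- rewrite -lerBlDl; apply: (geq v) => j Aj; rewrite lerBlDl -lerBlDr.
  apply: (geq u) => i Ai; rewrite lerBlDr.
  have [k Ak qk] := qD i j u v Ai Aj.
  exact: le_trans (lbq _ _ Ak) _.
- rewrite le_eqVlt => /orP[/eqP <-|t0].
    rewrite scale0r mul0r; have [i Ai] := q0; exact: le_trans (lbq _ _ Ai).
  rewrite -ler_pdivrMl//=; apply: geq => i Ai; rewrite ler_pdivrMl//.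
  by have [k Ak] := qZ i t v Ai t0; exact: le_trans (lbq _ _ Ak).
Qed.

(** Zorn's lemma: the pointwise infimum of a nonempty chain is again sublinear, and finite since
    each member dominates [- p (- v)]. *)
Lemma minimal_sublinear (p : V -> R) : sublinear p ->
  exists q, [/\ sublinear q, forall v, q v <= p v &
    forall q', sublinear q' -> (forall v, q' v <= q v) -> q' = q].
Proof.
move=> sp.
pose T := {q : V -> R | sublinear q /\ forall v, q v <= p v}.
pose mkT q (sq : sublinear q) (qp : forall v, q v <= p v) : T :=
  exist (fun q => sublinear q /\ forall v, q v <= p v) q (conj sq qp).
(* The order is reversed, so that a maximal element for Zorn is a minimal function. *)
pose le (s t : T) := `[< forall v, sval t v <= sval s v >].
have [| | | |[q [sq qp]] qmin] := @Zorn T le.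
- by move=> t; apply/asboolP.
- move=> r s t /asboolP rs /asboolP st; apply/asboolP => v.
  exact: le_trans (rs _).
- move=> [s hs] [t ht] /asboolP/= st /asboolP/= ts; apply: eq_exist => /=.
  by apply/funext => v; apply/eqP; rewrite eq_le st ts.
- move=> A Atot; have [A0|/set0P A0] := eqVneq A set0.
    by exists (mkT _ sp (fun v => lexx _)) => s; rewrite A0.
  have [||||sq qle] := @sublinear_inf T A sval (fun v => - p (- v)) A0.
  + move=> [q [sq qp]] v Aq /=.
    by apply: le_trans (sublinear_geN v sq); rewrite lerN2.
  + move=> q r u v Aq Ar.
    have [/asboolP qr|/asboolP rq] := Atot _ _ Aq Ar.
      exists r => //; apply: le_trans ((svalP r).1.1 _ _) _.
      by rewrite lerD2r.
    exists q => //; apply: le_trans ((svalP q).1.1 _ _) _.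
    by rewrite lerD2l.
  + by move=> q t v Aq t0; exists q => //; apply: (svalP q).1.2; exact: ltW.
  + by have [q Aq] := A0; exists q => //; rewrite (sublinear0 (svalP q).1).
  have qp v : inf [set sval i v | i in A] <= p v.
    have [q Aq] := A0; exact: le_trans (qle _ _ Aq) ((svalP q).2 v).
  exists (mkT _ sq qp) => s As; apply/asboolP => v /=.
  exact: qle.
exists q; split=> // q' sq' q'q.
have q'p v : q' v <= p v by exact: le_trans (qp v).
have := qmin (mkT _ sq' q'p).
move=> /(_ (introT (asboolP _) q'q)) e.
by have := congr1 sval e.
Qed.

(** A minimal sublinear function is linear. No subspace is extended from: the constraints wanted on
    [w] are encoded in [p] instead. *)
Lemma hahn_banach (p : V -> R) : sublinear p ->
  exists w : {linear V -> R^o}, forall v, w v <= p v.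
Proof.
move=> /minimal_sublinear[q [sq qp qmin]].
have qD u v : q (u + v) = q u + q v.
  apply/eqP; rewrite eq_le sq.1/=.
  (* For fixed [u] this infimum is sublinear and, by [t = 0], at most [q]; minimality makes it equal
     to [q], and then [t = 1] gives superadditivity. *)
  have [|||||sr rle] := @sublinear_inf R [set t | 0 <= t]
      (fun t v => q (v + t *: u) - t * q u) (fun v => - q (- v)).
  - by exists 0 => /=.
  - move=> t x /= t0; rewrite -(sublinearZ _ sq)//.
    have := sq.1 (x + t *: u) (- x); rewrite addrAC subrr add0r => ?; lra.
  - move=> s t x z /= s0 t0; exists (s + t); first exact: addr_ge0.
    rewrite scalerDl addrACA mulrDl.
    have := sq.1 (x + s *: u) (z + t *: u) => ?; lra.
  - move=> s t x /= s0 t0; exists (t * s); first by rewrite mulr_ge0// ltW.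
    by rewrite -scalerA -scalerDr (sublinearZ _ sq (ltW t0)) mulrBr mulrA.
  - by exists 0 => //=; rewrite scale0r addr0 mul0r subr0 sublinear0.
  pose r v := inf [set q (v + i *: u) - i * q u | i in [set t | 0 <= t]].
  have /qmin : sublinear r by [].
  have h x : r x <= q x.
    by have := rle 0 x; rewrite scale0r addr0 mul0r subr0; apply => /=.
  move=> /(_ h) e; have := rle 1 v ler01.
  rewrite -/(r v) (_ : r v = q v); last by rewrite e.
  by rewrite scale1r mul1r lerBrDr (addrC (q v)) (addrC v).
have qN v : q (- v) = - q v.
  by have := qD v (- v); rewrite subrr sublinear0// => /eqP;
    rewrite eq_sym addrC addr_eq0 => /eqP.
have qlin : linear (q : V -> R^o).
  move=> a u v; rewrite qD; congr (_ + _).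
  have [a0|a0] := leP 0 a; first by rewrite sublinearZ.
  rewrite -[a]opprK scaleNr qN sublinearZ//; last by rewrite oppr_ge0 ltW.
  by rewrite scaleNr.
pose w := HB.pack_for {linear V -> R^o} (q : V -> R^o)
  (GRing.isLinear.Build R V R^o *:%R q qlin).
by exists w.
Qed.
End HahnBanach.

(** * Clarke derivatives *)

Section Clarke.
Variables (R : realType) (V : normedModType R).
Implicit Types (F : V -> R) (x v : V).

(** Real-valued access to the Clarke derivative: the next two lemmas show that it is the infimum of
    these [a]. The bound holds at all base points near [x], which is what gluing directions
    requires. *)
Definition slope_le F x v (a : R) :=
  exists2 d : R, 0 < d &
    forall z (t : R), `|z - x| < d -> 0 < t -> t < d -> F (z + t *: v) - F z <= a * t.

Definition lipschitz_at F x :=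
  exists M : R, exists2 d : R, 0 < d &
    forall z z', `|z - x| < d -> `|z' - x| < d -> `|F z - F z'| <= M * `|z - z'|.

Lemma clarke_dd_lt_slope_le F x v (a : R) :
  (clarke_dd F x v < a%:E)%E -> slope_le F x v a.
Proof.
rewrite /clarke_dd limf_esupE => /ereal_inf_lt[_ [W [[P Q] /= [P0 Q0] PQW] <-]] sa.
move: P0 => /nbhs_ballP[d1 /= d1_0 dP].
move: Q0 => [d2 /= d2_0 dQ].
exists (Num.min d1 d2); first by rewrite lt_min d1_0.
move=> z t; rewrite !lt_min => /andP[zd _] t0 /andP[_ td].
have Wzt : W (z - x, t).
  apply: PQW; split => /=.
  - by apply: dP; rewrite -ball_normE/= sub0r normrN.
  - by apply: dQ => //=; rewrite sub0r normrN gtr0_norm.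
have : ((t^-1 * (F (x + (z - x) + t *: v) - F (x + (z - x))))%:E <= a%:E)%E.
  apply: le_trans (ltW sa); apply: ereal_sup_ubound.
  by exists (z - x, t).
have -> : x + (z - x) = z by rewrite addrC subrK.
by rewrite lee_fin ler_pdivrMl// (mulrC t).
Qed.

Lemma slope_le_clarke_dd F x v (a : R) :
  slope_le F x v a -> (clarke_dd F x v <= a%:E)%E.
Proof.
move=> [d d0 dF]; rewrite /clarke_dd limf_esupE.
pose W := [set p : V * R | `|p.1| < d /\ (0 < p.2 /\ p.2 < d)].
apply: (@le_trans _ _ (ereal_sup
    [set ((p.2^-1 * (F (x + p.1 + p.2 *: v) - F (x + p.1)))%:E) | p in W])).
  apply: ereal_inf_lbound; exists W => //.
  exists ([set z : V | `|z| < d], [set t : R | 0 < t /\ t < d]) => /=.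
    split.
      apply/nbhs_ballP; exists d => //= z; rewrite -ball_normE/= sub0r normrN//.
    exists d => //= t; rewrite /ball_/= sub0r normrN => td t0; split => //.
    exact: le_lt_trans (ler_norm _) td.
  by move=> [z t] [].
apply: ub_ereal_sup => _ [[z t] [/= zd [t0 td]] <-].
rewrite lee_fin ler_pdivrMl// (mulrC t); apply: dF => //.
by rewrite addrAC subrr add0r.
Qed.

Lemma opnorm_ge0 (W : normedModType R) (L : {linear V -> W}) : 0 <= opnorm L.
Proof.
rewrite /opnorm; set S := (X in sup X).
have S0 : S 0 by exists 0 => /=; rewrite ?normr0// linear0 normr0.
have [[_ hS]|hS] := pselect (has_sup S); last by rewrite sup_out.
exact: ub_le_sup.
Qed.

Lemma clarke_lambda_ge0 F x : 0 <= clarke_lambda F x.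
Proof.
rewrite /clarke_lambda; set S := (X in inf X).
have [->|/set0P S0] := eqVneq S set0; first by rewrite inf0.
by apply: lb_le_inf => // _ [w _ <-]; exact: opnorm_ge0.
Qed.

Lemma slope_leD F x u v a b :
  slope_le F x u a -> slope_le F x v b -> slope_le F x (u + v) (a + b).
Proof.
move=> [d d0 dF] [e e0 eF].
(* The step along [v] comes first and displaces the base point of the step along [u]; the first
   bound keeps this displacement below [d / 2]. *)
pose m := Num.min (d / (2 * (1 + `|v|))) (Num.min d (Num.min (d / 2) e)).
have v1 : 0 < 1 + `|v| by rewrite ltr_pwDl.
exists m; first by rewrite !lt_min !divr_gt0 ?mulr_gt0 ?d0.
move=> z t; rewrite !lt_min => /and4P[_ _ zd ze] t0 /and4P[tv td _ te].
have h1 : F (z + t *: v) - F z <= b * t by exact: eF.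
have h2 : F (z + t *: v + t *: u) - F (z + t *: v) <= a * t.
  apply: dF => //; rewrite addrAC; apply: le_lt_trans (ler_normD _ _) _.
  rewrite normrZ gtr0_norm//.
  move: tv; rewrite ltr_pdivlMr ?mulr_gt0// => tv.
  have := normr_ge0 v; nra.
rewrite scalerDr (addrC (t *: u)) addrA mulrDl; lra.
Qed.

Lemma slope_leZ F x v a (s : R) : 0 < s ->
  slope_le F x v a -> slope_le F x (s *: v) (s * a).
Proof.
move=> s0 [d d0 dF]; exists (Num.min d (d / s)); first by rewrite lt_min d0 divr_gt0.
move=> z t; rewrite !lt_min => /andP[zd _] t0 /andP[_ td].
rewrite scalerA (_ : s * a * t = a * (t * s)); last by ring.
by apply: dF => //; rewrite ?mulr_gt0// -ltr_pdivlMr.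
Qed.

(** Makes the set of slopes in each direction nonempty and bounded below, so that its infimum is a
    genuine real number. *)
Lemma slope_le_lipschitz F x : lipschitz_at F x ->
  exists M, forall v, slope_le F x v (M * `|v|) /\
    (forall a, slope_le F x v a -> - (M * `|v|) <= a).
Proof.
move=> [M [d d0 dF]]; exists M => v.
have v1 : 0 < 1 + `|v| by rewrite ltr_pwDl.
have near t z : `|z - x| < d / 2 -> 0 < t -> t < d / (2 * (1 + `|v|)) ->
    `|F (z + t *: v) - F z| <= M * `|v| * t.
  move=> zd t0; rewrite ltr_pdivlMr ?mulr_gt0// => td.
  have := dF (z + t *: v) z.
  rewrite (addrAC z (t *: v) (- z)) subrr add0r normrZ gtr0_norm//.
  rewrite (mulrC t) mulrA; apply; last by rewrite (lt_trans zd)//; lra.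
  rewrite addrAC; apply: le_lt_trans (ler_normD _ _) _.
  rewrite normrZ gtr0_norm//; have := normr_ge0 v; nra.
have m0 : 0 < Num.min (d / 2) (d / (2 * (1 + `|v|))).
  by rewrite lt_min !divr_gt0 ?mulr_gt0.
split=> [|a [e e0 eF]].
  exists (Num.min (d / 2) (d / (2 * (1 + `|v|)))) => // z t.
  rewrite !lt_min => /andP[zd _] t0 /andP[_ td].
  exact: le_trans (ler_norm _) (near _ _ zd t0 td).
pose t := Num.min (d / (2 * (1 + `|v|))) e / 2.
have t0 : 0 < t by rewrite divr_gt0// lt_min e0 divr_gt0 ?mulr_gt0.
have [t1 t2] : t < d / (2 * (1 + `|v|)) /\ t < e.
  apply/andP; rewrite -lt_min /t; move: t0; rewrite /t; lra.
have h1 : F (x + t *: v) - F x <= a * t by apply: eF; rewrite ?subrr ?normr0.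
have h2 : `|F (x + t *: v) - F x| <= M * `|v| * t.
  by apply: near => //; rewrite subrr normr0 divr_gt0.
have : - (M * `|v|) * t <= a * t.
  by apply: le_trans h1; move: h2; rewrite ler_norml mulNr => /andP[].
by rewrite ler_pM2r.
Qed.

(* Hahn-Banach is applied to the inf-convolution of the Clarke derivative with
   [e * `|.|], which is finite precisely because of the lower bound on slopes. *)
Lemma clarke_lambda_le F x (e : R) : 0 <= e -> lipschitz_at F x ->
  (forall v a, slope_le F x v a -> - (e * `|v|) <= a) ->
  clarke_lambda F x <= e.
Proof.
move=> e0 /slope_le_lipschitz[M HM] Fe.
pose p v := inf [set a | slope_le F x v a].
have ple v a : slope_le F x v a -> p v <= a.
  by move=> h; apply: ge_inf => //; exists (- (M * `|v|)) => b; exact: (HM v).2.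
have gep v b : (forall a, slope_le F x v a -> b <= a) -> b <= p v.
  by move=> h; apply: lb_le_inf => //; exists (M * `|v|); exact: (HM v).1.
have sp : sublinear p.
  split=> [u v|t v].
  - rewrite -lerBlDl; apply: (gep _) => b vb; rewrite lerBlDl -lerBlDr.
    apply: (gep _) => a ua; rewrite lerBlDr; apply: ple; exact: slope_leD.
  - rewrite le_eqVlt => /orP[/eqP <-|t0].
      rewrite scale0r mul0r; apply: ple; exists 1 => // z t' _ _ _.
      by rewrite scaler0 addr0 subrr mul0r.
    rewrite -ler_pdivrMl//; apply: (gep _) => a va; rewrite ler_pdivrMl//.
    by apply: ple; exact: slope_leZ.
have pe v : - (e * `|v|) <= p v by apply: (gep _) => a; exact: Fe.
have [|||||sq qle] := @sublinear_inf R V V setT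
    (fun u v => p (v + u) + e * `|u|) (fun v => - p (- v)).
- by exists 0.
- move=> u v _ /=; have := sp.1 (v + u) (- v); rewrite addrAC subrr add0r.
  have := pe u; lra.
- move=> u u' v v' _ _; exists (u + u') => //; rewrite addrACA.
  have := sp.1 (v + u) (v' + u'); have := ler_normD u u'; nra.
- move=> u t v _ t0; exists (t *: u) => //.
  rewrite -scalerDr (sublinearZ _ sp (ltW t0)) normrZ gtr0_norm//.
  by rewrite mulrDr mulrCA.
- by exists 0 => //; rewrite addr0 normr0 mulr0 addr0 (sublinear0 sp).
have [w wq] := hahn_banach sq.
(* In the inf-convolution, [u = 0] gives domination by [p], hence membership in the gradient, and
   [u = - v] gives the bound [e] on the norm of [w]. *)
have wp v : w v <= p v.
  by apply: le_trans (wq v) _; have := qle 0 v I; rewrite addr0 normr0 mulr0 addr0.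
have we1 v : w v <= e * `|v|.
  apply: le_trans (wq v) _; have := qle (- v) v I.
  by rewrite subrr normrN (sublinear0 sp) add0r.
have we v : `|w v| <= e * `|v|.
  by rewrite ler_norml we1 andbT lerNl -linearN -(normrN v); exact: we1.
have wcont : continuous w.
  apply/linear_bounded_continuous/linear_boundedP.
  exists e; split=> [|r /ltW er v]; first exact: num_real.
  exact: le_trans (we v) (ler_wpM2r _ er).
have wG : clarke_gradient F x w.
  (* A Clarke derivative below [w v - s] would make [w v - s] a slope, hence at least [p v], against
     [w v <= p v]. *)
  split=> // v; apply/lee_subgt0Pr => s s0; rewrite leNgt; apply/negP => h.
  have /ple := clarke_dd_lt_slope_le h.
  by have := wp v; lra.
apply: le_trans (_ : opnorm w <= e).
  by apply: ge_inf; [exists 0 => _ [u _ <-]; exact: opnorm_ge0|exists w].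
apply: ge_sup; first by exists `|w 0|; exists 0 => //=; rewrite normr0.
move=> _ [v /= v1 <-]; apply: le_trans (we v) _.
by rewrite -[leRHS]mulr1; exact: ler_wpM2l.
Qed.
End Clarke.

(** * Banach spaces and strict differentiability *)

(** Increments bounded by the decrease of a sequence bounded below telescope, so the sequence is
    Cauchy, with an explicit error. This serves both the open mapping argument and Ekeland's
    principle. *)
Lemma cvg_telescope (R : realType) (V : completeNormedModType R)
    (u : nat -> V) (b : nat -> R) (L : R) :
  (forall n, `|u n.+1 - u n| <= b n - b n.+1) -> (forall n, L <= b n) ->
  exists2 l, u @ \oo --> l & forall n, `|l - u n| <= b n - L.
Proof.
move=> ub Lb.
have step n k : `|u (n + k)%N - u n| <= b n - b (n + k)%N.
  elim: k => [|k ih]; first by rewrite addn0 !subrr normr0.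
  rewrite addnS; have := ub (n + k)%N.
  have := ler_normD (u (n + k).+1 - u (n + k)%N) (u (n + k)%N - u n).
  rewrite addrA subrK; lra.
have hinf : has_inf (range b) by split; [exists (b 0), 0|exists L => _ [n _ <-]].
have cu : cvgn u.
  apply/cauchy_cvgP/cauchy_exP => e e0.
  have [_ [N _ <-] bN] := inf_adherent e0 hinf.
  exists (u N); exists N => //= m /= Nm; rewrite -ball_normE/= distrC.
  rewrite -(subnKC Nm); apply: le_lt_trans (step _ _) _.
  have : inf (range b) <= b (N + (m - N))%N.
    by apply: ge_inf; [case: hinf|exists (N + (m - N))%N].
  lra.
exists (limn u) => // n; apply/ler_addgt0Pr => e e0.
have [N _ hN] := (iffLR (cvgrPdist_lt _ _) cu) e e0.
have := hN (n + N)%N (leq_addl _ _); have := step n N; have := Lb (n + N)%N.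
have := ler_normD (limn u - u (n + N)%N) (u (n + N)%N - u n).
rewrite addrA subrK/=; lra.
Qed.

Lemma continuous_linear_lipschitz (R : realType) (V W : normedModType R)
    (L : {linear V -> W}) : continuous L ->
  exists2 M : R, 0 < M & forall v, `|L v| <= M * `|v|.
Proof.
move=> cL; have /linear_boundedP := @continuous_linear_bounded _ _ _ 0 L (cL 0).
move=> [M [_ hM]]; exists (`|M| + 1); first by rewrite ltr_wpDl.
by apply: hM; have := ler_norm M; lra.
Qed.

(* Baire's theorem makes [L] almost open; completeness of the source then
   removes the closure by summing successive corrections. *)
Lemma bijective_linear_bounded_below (R : realType)
    (V W : completeNormedModType R) (L : {linear V -> W}) :
  continuous L -> bijective L ->
  exists2 k : R, 0 < k & forall v, k * `|v| <= `|L v|.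
Proof.
move=> cL [Li LK LiK].
(* By surjectivity these images cover [W], so by Baire some closure has an interior point. *)
pose A (n : nat) := L @` [set v | `|v| <= n%:R].
have [n nd] : exists n, ~ dense (~` closure (A n)).
  apply: contrapT => /forallNP h.
  have /Baire : forall n, open (~` closure (A n)) /\ dense (~` closure (A n)).
    move=> n; split; last exact: contrapT (h n).
    by apply: closed_openC; exact: closed_closure.
  move=> /(_ setT); case; [by exists 0|exact: openT|move=> w [_ hw]].
  have [N hN] : exists N : nat, `|Li w| <= N%:R.
    by exists (Num.bound `|Li w|); apply/ltW; rewrite archi_boundP.
  apply: (hw N I); apply: subset_closure; exists (Li w) => //.
have [w0 [r r0 hr]] : exists w0, exists2 r : R, 0 < r &
    forall w, `|w - w0| < r -> closure (A n) w.
  have [U [ne oU UA0]] : exists U : set W,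
      [/\ U !=set0, open U & U `&` ~` closure (A n) = set0].
    apply: contrapT => /forallNP h; apply: nd => U ne oU.
    by apply/set0P/negP => /eqP UA0; apply: (h U).
  have [w0 Ow0] := ne.
  have /nbhs_ballP[r /= r0 rO] := open_nbhs_nbhs (conj oU Ow0).
  exists w0, r => // w wr; apply: contrapT => h.
  have : (U `&` ~` closure (A n)) w.
    by split => //; apply: rO; rewrite -ball_normE/= distrC.
  by rewrite UA0.
(* Subtracting an approximate preimage of the centre [w0] moves the ball to the origin and doubles
   the radius [n]. *)
have approx w e : `|w| < r -> 0 < e ->
    exists2 v, `|v| <= 2 * n%:R & `|L v - w| < e.
  move=> wr e0.
  have nearA z : `|z - w0| < r -> exists2 v, `|v| <= n%:R & `|L v - z| < e / 2.
    move=> zr; have [|_ [[v vn <-] ]] := hr z zr (ball z (e / 2)).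
      by apply: nbhsx_ballx; rewrite divr_gt0.
    by rewrite -ball_normE/= distrC => h; exists v.
  have [|v1 v1n v1e] := nearA (w0 + w); first by rewrite addrAC subrr add0r.
  have [|v0 v0n v0e] := nearA w0; first by rewrite subrr normr0.
  exists (v1 - v0).
    by apply: le_trans (ler_normB _ _) _; lra.
  rewrite linearB/= (_ : _ - _ - w = (L v1 - (w0 + w)) - (L v0 - w0)).
    by apply: le_lt_trans (ler_normB _ _) _; lra.
  by rewrite opprB opprD -[RHS]addrA addrACA addNr add0r (addrC (- w)) addrA.
(* Rescaling [w] to norm [r / 2] turns the bound [2 * n] into [4 * n / r] times the norm of [w];
   [n.+1] keeps [C] positive when [n = 0]. *)
have [C CE] : exists C, C = 4 * n.+1%:R / r by exists (4 * n.+1%:R / r).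
have C0 : 0 < C by rewrite CE divr_gt0// mulr_gt0// ltr0n.
have half w : exists v, `|v| <= C * `|w| /\ `|L v - w| <= `|w| / 2.
  have [->|w0'] := eqVneq w 0.
    by exists 0; split; [rewrite !normr0 mulr0|rewrite linear0 subr0 !normr0 mul0r].
  have nw : 0 < `|w| by rewrite normr_gt0.
  pose s := r / (2 * `|w|); have s0 : 0 < s by rewrite divr_gt0// mulr_gt0.
  have sw : s * `|w| = r / 2 by rewrite /s; field; rewrite gt_eqF.
  have [||v vn ve] := approx (s *: w) (s * `|w| / 2).
  - by rewrite normrZ gtr0_norm// sw; lra.
  - by rewrite divr_gt0// mulr_gt0.
  exists (s^-1 *: v); split.
    rewrite normrZ gtr0_norm ?invr_gt0// ler_pdivrMl// mulrCA sw.
    apply: le_trans vn _; rewrite CE (_ : _ * (r / 2) = 2 * n.+1%:R).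
      by rewrite ler_pM2l// ler_nat.
    by field; rewrite gt_eqF.
  rewrite linearZ/= -[X in _ - X](scalerK (lt0r_neq0 s0)) -scalerBr normrZ.
  by rewrite gtr0_norm ?invr_gt0// ler_pdivrMl// mulrA ltW.
have [g hg] := choice half.
exists (2 * C)^-1; first by rewrite invr_gt0 mulr_gt0.
move=> v; rewrite ler_pdivrMl ?mulr_gt0//.
(* [res k] is what remains of [L v] after [k] corrections, at most half of the previous remainder;
   the corrections sum to a preimage with norm at most [2 * C] times that of [L v]. *)
pose res k := iter k (fun w => w - L (g w)) (L v).
pose S k := \sum_(i < k) g (res i).
pose b k := 2 * C * `|L v| / 2 ^+ k.
have resS k : res k.+1 = res k - L (g (res k)) by [].
have resE k : `|res k| <= `|L v| / 2 ^+ k.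
  elim: k => [|k ih]; first by rewrite expr0 divr1.
  rewrite resS distrC; apply: le_trans (hg _).2 _.
  by rewrite exprS invfM (mulrC 2^-1) mulrA ler_pM2r.
have SS k : S k.+1 = S k + g (res k) by rewrite /S big_ord_recr.
have LS k : L (S k) = L v - res k.
  elim: k => [|k ih]; first by rewrite /S big_ord0 linear0 subrr.
  by rewrite SS linearD ih resS opprB addrA addrAC.
have [||l Sl Sb] := @cvg_telescope R V S b 0.
- move=> k; rewrite SS addrAC subrr add0r.
  apply: le_trans (hg _).1 _; have := resE k; rewrite -(ler_pM2l C0).
  have -> : b k - b k.+1 = C * (`|L v| / 2 ^+ k).
    by rewrite /b exprS; field; rewrite expf_neq0.
  by [].
- by move=> k; rewrite /b divr_ge0 ?exprn_ge0// mulr_ge0// mulr_ge0// ltW.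
have lv : l = v.
  apply: (can_inj LK); apply/eqP; rewrite -subr_eq0 -normr_eq0 eq_le normr_ge0 andbT.
  have [M M0 LM] := continuous_linear_lipschitz cL.
  (* Continuity of [L] in quantitative form: the distance from [L l] to [L v] is at most
     [K / 2 ^+ k] for every [k], hence zero. *)
  pose K := M * (2 * C * `|L v|) + `|L v|.
  have lK k : `|L l - L v| * 2 ^+ k <= K.
    rewrite -ler_pdivlMr ?exprn_gt0//.
    have -> : K / 2 ^+ k = M * b k + `|L v| / 2 ^+ k by rewrite /K /b; ring.
    have -> : L l - L v = L (l - S k) - res k.
      by rewrite linearB LS opprB addrA addrAC addrK.
    apply: le_trans (ler_normB _ _) (lerD _ (resE k)).
    apply: le_trans (LM _) _; rewrite ler_pM2l//.
    by have := Sb k; rewrite subr0.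
  rewrite leNgt; apply/negP => x0.
  have := lK (Num.bound (K / `|L l - L v|)); apply/negP; rewrite -ltNge.
  rewrite mulrC -ltr_pdivrMr//; apply: lt_trans (archi_boundP _) _.
    apply: divr_ge0 => //; rewrite /K.
    have := normr_ge0 (L v); have := ltW M0; have := ltW C0 => *.
    by rewrite addr_ge0// !mulr_ge0.
  by rewrite -natrX ltr_nat ltn_expl.
have := Sb 0; rewrite /S big_ord0 subr0 lv subr0 /b expr0 divr1.
by [].
Qed.

(** Hahn-Banach applied to the infimum over [t >= 0] of the norm of [v + t *: u] minus [t] times the
    norm of [u]: [t = 0] bounds [w] by the norm, and [t = 1] at [- u] forces equality at [u]. *)
Lemma norming_functional (R : realType) (V : normedModType R) (u : V) :
  exists w : {linear V -> R^o}, (forall v, `|w v| <= `|v|) /\ w u = `|u|.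
Proof.
have [|||||sq qle] := @sublinear_inf R V R [set t | 0 <= t]
    (fun t v => `|v + t *: u| - t * `|u|) (fun v => - `|v|).
- by exists 0 => /=.
- move=> t v /= t0; have := ler_normB (v + t *: u) v.
  by rewrite addrAC subrr add0r normrZ ger0_norm//; lra.
- move=> s t x z /= s0 t0; exists (s + t); first exact: addr_ge0.
  rewrite scalerDl addrACA mulrDl.
  have := ler_normD (x + s *: u) (z + t *: u); lra.
- move=> s t x /= s0 t0; exists (t * s); first by rewrite mulr_ge0// ltW.
  by rewrite -scalerA -scalerDr normrZ gtr0_norm// mulrBr mulrA.
- by exists 0 => //=; rewrite scale0r addr0 mul0r subr0 normr0.
have [w wq] := hahn_banach sq.
have wv v : w v <= `|v|.
  apply: le_trans (wq v) _; have := qle 0 v (lexx 0).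
  by rewrite scale0r addr0 mul0r subr0.
exists w; split=> [v|].
  by rewrite ler_norml wv andbT lerNl -linearN -(normrN v); exact: wv.
apply/eqP; rewrite eq_le wv -lerN2 -linearN/=.
apply: le_trans (wq _) _; have := qle 1 (- u) ler01.
by rewrite scale1r addNr normr0 mul1r sub0r.
Qed.

Lemma opnorm_ub (R : realType) (V W : normedModType R) (L : {linear V -> W}) v :
  continuous L -> `|L v| <= opnorm L * `|v|.
Proof.
move=> /continuous_linear_lipschitz[M M0 LM].
have [->|v0] := eqVneq v 0; first by rewrite linear0 !normr0 mulr0.
have nv : 0 < `|v| by rewrite normr_gt0.
rewrite -ler_pdivrMr// mulrC -[X in X * _]gtr0_norm ?invr_gt0// -normrZ -linearZ.
apply: ub_le_sup; last first.
  exists (`|v|^-1 *: v) => //=.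
  by rewrite normrZ gtr0_norm ?invr_gt0// mulVf// gt_eqF.
exists M => _ [u /= u1 <-]; apply: le_trans (LM u) _.
by rewrite -[leRHS]mulr1 ler_pM2l.
Qed.

(** A norming functional of the error reduces the claim to the real mean value theorem on the
    segment from [z'] to [z], which stays in the ball where ['d f] is within [e] of ['d f x]. *)
Lemma C1_strictly_differentiable (R : realType) (V W : normedModType R)
    (f : V -> W) (x : V) (e : R) : C1 f -> 0 < e ->
  exists2 d : R, 0 < d & forall z z', `|z - x| < d -> `|z' - x| < d ->
    `|f z - f z' - 'd f x (z - z')| <= e * `|z - z'|.
Proof.
move=> [df dfc] e0.
have [d /= d0 hd] := iffLR (nbhs_ballP _ _) (iffLR (cvgrPdist_lt _ _) (dfc x) e e0).
exists d => // z z' zd z'd.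
have [w [w1 wu]] := norming_functional (f z - f z' - 'd f x (z - z')).
have wcont : continuous w.
  apply/linear_bounded_continuous/linear_boundedP.
  exists 1; split=> [|r /ltW r1 v]; first exact: num_real.
  by apply: le_trans (w1 v) _; rewrite -[leLHS]mul1r; exact: ler_wpM2r.
pose g (s : R) := z' + s *: (z - z').
pose p (s : R) : R := w (f (g s) - s *: 'd f x (z - z')).
pose dp (s : R) : R := w ('d f (g s) (z - z') - 'd f x (z - z')).
have dgs (s : R) : is_diff s g (fun t => t *: (z - z')).
  have -> : g = (cst z' + ( *:%R ^~ (z - z')))%R by apply/funext.
  by apply: is_diff_eq; apply/funext => t; rewrite /= add0r.
have dp' (s : R) : is_diff s p
    (fun t => w ('d f (g s) (t *: (z - z')) - t *: 'd f x (z - z'))).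
  have dfg := is_diff_comp (dgs s) (differentiableP (df (g s))).
  have dB := is_diffB dfg (is_diff_scalel s ('d f x (z - z'))).
  have dw y : is_diff y (w : W -> R^o) w.
    by apply: DiffDef; [exact: linear_differentiable|rewrite diff_lin].
  exact: (is_diff_comp dB (dw _)).
have pder (s : R) : is_derive s (1 : R) p (dp s).
  have [ps pd] := dp' s.
  apply: DeriveDef; first exact: diff_derivable.
  by rewrite deriveE// pd !scale1r.
have [|c] := @MVT R p dp 0 1 ltr01 (fun s _ => pder s).
  apply: continuous_subspaceT => s.
  by apply: differentiable_continuous; case: (dp' s).
rewrite in_itv/= => /andP[c0 c1]; rewrite subr0 mulr1 => pE.
rewrite -wu.
have -> : w (f z - f z' - 'd f x (z - z')) = p 1 - p 0.
  have zz : z' + (z - z') = z by rewrite addrC subrK.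
  by rewrite /p /g !scale1r !scale0r addr0 subr0 zz -linearB addrAC.
rewrite pE; apply: le_trans (ler_norm _) _; apply: le_trans (w1 _) _.
have gc : ball x d (g c).
  rewrite -ball_normE/= /g.
  have -> : x - (z' + c *: (z - z')) = (1 - c) *: (x - z') + c *: (x - z).
    rewrite [RHS](_ : _ = x - z' + c *: (- (x - z') + (x - z))).
      by rewrite opprD addrA -scalerN !opprB addrA subrK.
    by rewrite scalerBl scale1r -addrA -scalerN -scalerDr.
  apply: le_lt_trans (ler_normD _ _) _; rewrite !normrZ.
  rewrite gtr0_norm ?subr_gt0// gtr0_norm// (distrC x z) (distrC x z').
  nra.
have clin : continuous ('d f (g c) \- 'd f x).
  by move=> v; apply: cvgB; exact: diff_continuous.
apply: le_trans (opnorm_ub _ clin) _; apply: ler_wpM2r => //.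
by have := hd _ gc; rewrite sub0r normrN => /ltW; exact/le_trans/ler_norm.
Qed.

(** * The functional [|f - y|^2 / 2] *)

Section DistFunctional.
Variables (R : realType) (V W : normedModType R) (f : V -> W) (y : W).
Hypothesis f1 : C1 f.

Lemma C1_lipschitz_at (x : V) : exists M : R, exists2 d : R, 0 < d &
  forall z z', `|z - x| < d -> `|z' - x| < d -> `|f z - f z'| <= M * `|z - z'|.
Proof.
have cdf : continuous 'd f x by apply: diff_continuous; exact: f1.1.
have [M M0 hM] := continuous_linear_lipschitz cdf.
have [d d0 hd] := C1_strictly_differentiable x f1 ltr01.
exists (M + 1), d => // z z' zd z'd.
rewrite -[f z - f z'](subrK ('d f x (z - z'))).
apply: le_trans (ler_normD _ _) _.
by have := hd _ _ zd z'd; have := hM (z - z'); lra.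
Qed.

Lemma dist_functional_lipschitz_at (x : V) :
  lipschitz_at (dist_functional f y) x.
Proof.
have [M [d d0 hM]] := C1_lipschitz_at x.
exists (`|M| * (`|f x - y| + `|M| * d)), d => // z z' zd z'd.
have fd u : `|u - x| < d -> `|f u - y| <= `|f x - y| + `|M| * d.
  move=> ud; have -> : f u - y = (f u - f x) + (f x - y) by rewrite addrA subrK.
  have := ler_normD (f u - f x) (f x - y).
  have := hM u x ud; rewrite subrr normr0 => /(_ d0).
  have := ler_norm M; have := normr_ge0 (u - x); have := normr_ge0 M; nra.
rewrite /dist_functional -mulrBr subr_sqr !normrM gtr0_norm ?invr_gt0//.
have h1 : `| `|f z - y| - `|f z' - y| | <= `|M| * `|z - z'|.
  apply: le_trans (ler_dist_dist _ _) _.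
  rewrite opprB addrA subrK.
  by apply: le_trans (hM z z' zd z'd) _; apply: ler_wpM2r => //; exact: ler_norm.
have h2 : `| `|f z - y| + `|f z' - y| | <= 2 * (`|f x - y| + `|M| * d).
  by rewrite ger0_norm ?addr_ge0//; have := fd z zd; have := fd z' z'd; lra.
have := ler_pM (normr_ge0 _) (normr_ge0 _) h1 h2; lra.
Qed.

Lemma dist_functional_continuous : continuous (dist_functional f y).
Proof.
move=> x; have fx : {for x, continuous f}.
  by apply: differentiable_continuous; exact: f1.1.
rewrite /dist_functional; apply: cvgM; first exact: cvg_cst.
rewrite expr2; under eq_fun do rewrite expr2.
by apply: cvgM; apply: cvg_norm; apply: cvgB => //; exact: cvg_cst.
Qed.

(* The Newton direction at [x] decreases the functional at a definite rate in
   a whole neighbourhood of [x], by strict differentiability. *)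
Lemma dist_functional_slope (x : V) : (exists v, 'd f x v = y - f x) ->
  f x != y -> exists v, exists c d : R, [/\ 0 < c, 0 < d &
    forall z, `|z - x| < d -> slope_le (dist_functional f y) z v (- c)].
Proof.
move=> [v vE] fxy.
have m0 : 0 < `|f x - y| by rewrite normr_gt0 subr_eq0.
set m := `|f x - y| in m0.
(* With this tolerance a step [t *: v] has linearization error at most [t * m / 8]; below, [f] is
   also kept within [m / 8] of [f x]. *)
have e0 : 0 < m / (8 * (1 + `|v|)).
  by rewrite divr_gt0// mulr_gt0// ltr_pwDl.
have [d d0 hd] := C1_strictly_differentiable x f1 e0.
have fx : {for x, continuous f}.
  by apply: differentiable_continuous; exact: f1.1.
have m8 : 0 < m / 8 by rewrite divr_gt0.
have [d' /= d'0 hd'] := iffLR (nbhs_ballP _ _) (iffLR (cvgrPdist_lt _ _) fx _ m8).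
(* One third each for the distance from [x] to [z], from [z] to [z1], and for the step [t *: v]. *)
exists v, (m ^+ 2 / 4), (Num.min d d' / 3); split.
- by rewrite divr_gt0// exprn_gt0.
- by rewrite divr_gt0// lt_min d0.
move=> z zx.
have dd : 0 < Num.min d d' by rewrite lt_min d0.
exists (Num.min 1 (Num.min d d' / (3 * (1 + `|v|)))).
  by rewrite lt_min ltr01 divr_gt0// mulr_gt0// ltr_pwDl.
move=> z1 t; rewrite lt_min => /andP[_ z1z] t0; rewrite lt_min => /andP[t1].
rewrite ltr_pdivlMr ?mulr_gt0 ?ltr_pwDl// => td.
have v0 := normr_ge0 v.
have z1v : `|z1 - z| < Num.min d d' / 3.
  apply: lt_le_trans z1z _; rewrite ler_pM2l// lef_pV2 ?posrE ?mulr_gt0 ?ltr_pwDl//.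
  lra.
have z1x : `|z1 - x| < 2 * (Num.min d d' / 3).
  have -> : z1 - x = (z1 - z) + (z - x) by rewrite addrA subrK.
  by have := ler_normD (z1 - z) (z - x); lra.
have ztx : `|z1 + t *: v - x| < Num.min d d'.
  rewrite addrAC; have := ler_normD (z1 - x) (t *: v).
  by rewrite normrZ gtr0_norm//; nra.
have := ztx; rewrite lt_min => /andP[ztd _].
have : `|z1 - x| < Num.min d d' by lra.
rewrite lt_min => /andP[z1d z1d'].
have h1 := hd _ _ ztd z1d.
have h2 : `|f x - f z1| < m / 8 by apply: hd'; rewrite -ball_normE/= distrC.
move: h1; rewrite (addrAC z1 (t *: v) (- z1)) subrr add0r linearZ vE normrZ gtr0_norm//.
set a := f z1 - y; set b := f (z1 + t *: v) - y => h1.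
(* The Newton step contracts the residual [a] by [1 - t] up to two errors of size [t * m / 8]; as
   [a] has norm at least [7 * m / 8], its norm drops by more than [t * m / 2]. *)
have ab : `|b| <= (1 - t) * `|a| + t * `|f x - f z1| + m / 8 * t.
  have -> : b = (1 - t) *: a - t *: (f x - f z1) +
      (f (z1 + t *: v) - f z1 - t *: (y - f x)).
    have -> : f (z1 + t *: v) - f z1 = b - a.
      by rewrite /a /b opprB addrA subrK.
    have -> : y - f x = - ((f x - f z1) + a) by rewrite /a addrA subrK opprB.
    have key (A B D : W) : B = (1 - t) *: A - t *: D + (B - A - t *: - (D + A)).
      rewrite scalerN opprK scalerDr scalerBl scale1r -[X in _ = X + _]addrA.
      rewrite -opprD [in RHS](addrC (t *: D) (t *: A)).
      by rewrite addrACA addNr addr0 addrC subrK.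
    exact: key.
  apply: le_trans (ler_normD _ _) _; apply: lerD.
    apply: le_trans (ler_normB _ _) _; rewrite !normrZ gtr0_norm ?subr_gt0//.
    by rewrite gtr0_norm.
  apply: le_trans h1 _; rewrite -subr_ge0.
  rewrite (_ : _ - _ = t * m / 8 * (1 - `|v| / (1 + `|v|))); last first.
    by field; rewrite gt_eqF// ltr_pwDl.
  rewrite mulr_ge0 ?divr_ge0 ?mulr_ge0 ?ltW// subr_gt0 ltr_pdivrMr ?ltr_pwDl//.
  by rewrite mul1r ltrDr.
have am : m - m / 8 <= `|a|.
  have : m <= `|f x - f z1| + `|a|.
    by rewrite /m (_ : f x - y = (f x - f z1) + a) ?ler_normD// /a addrA subrK.
  lra.
have ab' : `|b| <= `|a| - t * m / 2.
  apply: le_trans ab _; have := ltW h2; nra.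
rewrite /dist_functional -/a -/b -mulrBr.
have : `|b| ^+ 2 <= (`|a| - t * m / 2) ^+ 2.
  by rewrite lerXn2r ?nnegrE// (le_trans _ ab').
have tm : t * t * m * m <= t * m * m.
  by rewrite !ler_pM2r// -[leRHS]mulr1 ler_pM2l// ltW.
have tm2 : t * m * (m - m / 8) <= t * m * `|a| by rewrite ler_pM2l// mulr_gt0.
have tmm : 0 <= t * m * m by rewrite !mulr_ge0// ltW.
rewrite !expr2; lra.
Qed.
End DistFunctional.

(** Spheres need not be compact, so the bound is quantitative: ['d f x] expands by at least [k], and
    the linearization error [k / 2] leaves an expansion of [f] around [x] by [k / 2]. *)
Lemma dist_functional_moat (R : realType) (V W : completeNormedModType R)
    (f : V -> W) (x : V) : C1 f -> bijective ('d f x) ->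
  exists2 r0 : R, 0 < r0 & forall r, 0 < r -> r < r0 ->
    exists2 c : R, 0 < c &
      forall z, `|z - x| = r -> c <= dist_functional f (f x) z.
Proof.
move=> f1 bij.
have cdf : continuous 'd f x by apply: diff_continuous; exact: f1.1.
have [k k0 hk] := bijective_linear_bounded_below cdf bij.
have k2 : 0 < k / 2 by rewrite divr_gt0.
have [d d0 hd] := C1_strictly_differentiable x f1 k2.
exists d => // r r0 rd; exists (2^-1 * (k / 2 * r) ^+ 2).
  by rewrite mulr_gt0// exprn_gt0// mulr_gt0.
move=> z zr; rewrite /dist_functional ler_pM2l//.
have kr : 0 <= k / 2 * r by rewrite mulr_ge0// ltW.
rewrite lerXn2r ?nnegrE//.
have := hd z x; rewrite zr subrr normr0 => /(_ rd d0).
have := hk (z - x); rewrite zr.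
have := ler_normB (f z - f x) (f z - f x - 'd f x (z - x)).
rewrite opprB addrCA subrr addr0. lra.
Qed.

(** * Weights with divergent integral *)

Section Weight.
Variables (R : realType) (h : R -> R).
Hypothesis hadm : admissible_weight h.
Let mu := @lebesgue_measure R.
Let g (r : R) : \bar R := ((1 + h r)^-1)%:E.

Let h0 r : 0 <= r -> 0 <= h r. Proof. by case: hadm => _ _ + _; exact. Qed.

Let hle r s : 0 <= r -> r <= s -> h r <= h s.
Proof.
move=> r0 rs; have [_ + _ _] := hadm; apply => //.
  by rewrite in_itv/= r0.
by rewrite in_itv/= (le_trans r0 rs).
Qed.

Let g0 r : 0 <= r -> (0 <= g r)%E.
Proof. by move=> r0; rewrite lee_fin invr_ge0 addr_ge0// h0. Qed.

Let mg (A : set R) : measurable A -> A `<=` `[0, +oo[ ->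
  measurable_fun A g.
Proof.
move=> mA A0; apply/measurable_EFinP.
have : measurable_fun (`[0, +oo[%classic : set R) (fun r => (1 + h r)^-1); last first.
  exact: measurable_funS.
apply: subspace_continuous_measurable_fun => //.
have [hc _ _ _] := hadm.
apply: (@within_continuous_comp _ _ _ _ h (fun u => (1 + u)^-1)) => // u.
rewrite inE => -[r /=]; rewrite in_itv/= andbT => r0 <-.
apply: cvgV; first by rewrite gt_eqF// ltr_pwDl// h0.
by apply: cvgD; [exact: cvg_cst|exact: cvg_id].
Qed.

Let G (s : R) := (\int[mu]_(x in `[0%R, s]) g x)%E.

Let itv_sub (s : R) : `[0, s] `<=` (`[0, +oo[ : set R).
Proof. by move=> x /=; rewrite !in_itv/= => /andP[->]. Qed.

Let G_mono (r s : R) : r <= s -> (G r <= G s)%E.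
Proof.
move=> rs; apply: ge0_subset_integral => //.
- by apply: mg => //; exact: itv_sub.
- by move=> x /=; rewrite in_itv/= => /andP[x0 _]; exact: g0.
- move=> x /=; rewrite !in_itv/= => /andP[-> xr]; exact: le_trans xr rs.
Qed.

Let G_step (r s : R) : 0 <= r -> r <= s ->
  (G s <= G r + ((s - r) / (1 + h r))%:E)%E.
Proof.
move=> r0 rs.
have rsE : `[0, s]%classic = `[0, r] `|` `]r, s].
  apply/seteqP; split => x /=; rewrite !in_itv/=.
    by move=> /andP[-> ->]; rewrite andbT; case: (leP x r); [left|right].
  by move=> [/andP[-> xr]|/andP[rx ->]]; rewrite ?andbT;
    [exact: le_trans rs|exact: le_trans (ltW rx)].
have sub : `]r, s] `<=` (`[0, +oo[ : set R).
  by move=> x /=; rewrite !in_itv/= andbT => /andP[rx _]; exact: le_trans (ltW rx).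
rewrite /G rsE ge0_integral_setU//=.
- apply: leeD2l.
  apply: (@le_trans _ _ (\int[mu]_(x in `]r, s]) (cst (g r) x))%E).
    apply: ge0_le_integral => //.
    + by move=> x xrs; have := sub _ xrs; rewrite /= in_itv/= andbT => /g0.
    + exact: mg.
    + move=> x /=; rewrite in_itv/= => /andP[rx _].
      rewrite lee_fin lef_pV2 ?posrE ?ltr_pwDl ?h0 ?(le_trans r0 (ltW rx))//.
      by rewrite lerD2l hle// ltW.
  rewrite integral_cst//= lebesgue_measure_itv/= lte_fin.
  case: ifPn => rs'; last by rewrite mule0 lee_fin divr_ge0 ?subr_ge0// addr_ge0// h0.
  by rewrite -EFinB -EFinM lee_fin mulrC.
- apply: mg; first exact: measurableU.
  by move=> x [/itv_sub|/sub].
- by move=> x [/itv_sub|/sub]; rewrite /= in_itv/= andbT; exact: g0.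
- apply/disj_setPS => x [] /=; rewrite !in_itv/= => /andP[_ xr] /andP[rx _].
  by have := le_lt_trans xr rx; rewrite ltxx.
Qed.

(** With [G] the integral of [1 / (1 + h)] from [0], each step raises [G (r n)] by at most the drop
    of [b], since the integrand is nonincreasing. So [G (r n)] stays bounded, whereas [G] is
    unbounded. *)
Lemma weighted_steps_bounded (r b : nat -> R) (L : R) :
  (forall n, 0 <= r n) -> (forall n, b n.+1 <= b n) -> (forall n, L <= b n) ->
  (forall n, r n.+1 <= r n + (b n - b n.+1) * (1 + h (r n))) ->
  exists B, forall n, r n <= B.
Proof.
move=> r0 bb Lb rb.
have Gr n : (G (r n) <= G (r 0%N) + (b 0%N - b n)%:E)%E.
  elim: n => [|n ih]; first by rewrite subrr adde0.
  have [rr|/ltW rr] := leP (r n.+1) (r n).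
    apply: le_trans (G_mono rr) _; apply: le_trans ih _.
    by apply: leeD2l; rewrite lee_fin lerD2l lerN2.
  apply: le_trans (G_step (r0 n) rr) _.
  apply: (@le_trans _ _ (G (r 0%N) + (b 0%N - b n)%:E + (b n - b n.+1)%:E)%E).
    apply: leeD => //; rewrite lee_fin ler_pdivrMr ?ltr_pwDl ?h0//.
    by rewrite lerBlDl.
  rewrite -addeA -EFinD; apply: leeD2l; rewrite lee_fin; lra.
(* The integrand is at most [1]; this makes the bound on all [G (r n)] finite. *)
have G0 : (G (r 0%N) <= (r 0%N)%:E)%E.
  apply: (@le_trans _ _ (G 0 + ((r 0%N - 0) / (1 + h 0))%:E)%E); first exact: G_step.
  have -> : G 0 = 0%E by rewrite /G set_itv1 integral_set1.
  rewrite add0e subr0 lee_fin ler_pdivrMr ?ltr_pwDl ?h0//.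
  by rewrite ler_peMr// lerDl h0.
apply: contrapT => /forallNP nB.
have Gm (m : nat) : (G m%:R <= (r 0%N + (b 0%N - L))%:E)%E.
  have [n mn] : exists n, m%:R < r n.
    by have /existsNP[n /negP] := nB m%:R; rewrite -ltNge; exists n.
  apply: le_trans (G_mono (ltW mn)) _; apply: le_trans (Gr n) _.
  rewrite (EFinD (r 0%N)); apply: leeD => //.
  by rewrite lee_fin lerD2l lerN2.
have [_ _ _ hoo] := hadm.
have itvE : `[0, +oo[%classic = \bigcup_(m : nat) (`[0, m%:R]%classic : set R).
  apply/seteqP; split => x /=; rewrite in_itv/=.
    rewrite andbT => x0; exists (Num.bound x) => //=.
    by rewrite in_itv/= x0 ltW// archi_boundP.
  by move=> [m _ /=]; rewrite !in_itv/= => /andP[->].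
have cG : G m%:R @[m --> \oo] --> (\int[mu]_(x in `[0%R, +oo[) g x)%E.
  rewrite itvE; apply: ge0_nondecreasing_set_cvg_integral => //.
  - move=> m n mn; apply/subsetPset => x /=; rewrite !in_itv/= => /andP[->].
    by move=> /le_trans; apply; rewrite ler_nat.
  - by move=> i; apply: mg => //; exact: itv_sub.
  - by move=> i x /=; rewrite in_itv/= => /andP[x0 _]; exact: g0.
have goo : (\int[mu]_(x in `[0%R, +oo[) g x = +oo)%E by exact: hoo.
have : (limn (fun m => G m%:R) <= (r 0%N + (b 0%N - L))%:E)%E.
  by apply: lime_le; [exact: cvgP cG|exact: nearW].
by rewrite (cvg_lim _ cG)// goo leye_eq.
Qed.
End Weight.

(** * Weighted Ekeland principle *)

Lemma weight_continuous (R : realType) (h : R -> R) (r e : R) :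
  admissible_weight h -> 0 <= r -> 0 < e ->
  exists2 d : R, 0 < d & forall s, 0 <= s -> `|r - s| < d -> `|h r - h s| < e.
Proof.
move=> [/subspace_continuousP hc _ _ _] r0 e0.
have rI : `[0, +oo[%classic r by rewrite /= in_itv/= r0.
have /nbhs_ballP[d /= d0 hd] : within `[0, +oo[ (nbhs r) (fun s => `|h r - h s| < e).
  by move/cvgrPdist_lt: (hc r rI); exact.
exists d => // s s0 rs.
by apply: hd => //; rewrite /= in_itv/= s0.
Qed.

Section Ekeland.
Variables (R : realType) (X : completeNormedModType R) (F : X -> R).
Variables (T : Type) (t0 : T) (Gamma : set (T -> X)) (h : R -> R).
Hypothesis F_cont : continuous F.
Hypothesis F_ge0 : forall x, 0 <= F x.
Hypothesis h_adm : admissible_weight h.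
Hypothesis Gamma_bound : forall g, Gamma g ->
  has_ubound (range (F \o g)) /\ has_ubound (range (fun t => `|g t|)).
Hypothesis Gamma_closed : forall (u : nat -> T -> X) (g : T -> X),
  (forall n, Gamma (u n)) ->
  (forall e : R, 0 < e -> exists n, forall t, `|g t - u n t| < e) -> Gamma g.

Let Phi (g : T -> X) : R := sup (range (F \o g)).
Let N (g : T -> X) : R := sup (range (fun t => `|g t|)).

Let Phi_ge g t : Gamma g -> F (g t) <= Phi g.
Proof. by move=> /Gamma_bound[ub _]; apply: ub_le_sup => //; exists t. Qed.

Let Phi_le g c : (forall t, F (g t) <= c) -> Phi g <= c.
Proof.
move=> gc; apply: ge_sup; first by exists (F (g t0)), t0.
by move=> _ [t _ <-]; exact: gc.
Qed.

Let N_ge g t : Gamma g -> `|g t| <= N g.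
Proof. by move=> /Gamma_bound[_ ub]; apply: ub_le_sup => //; exists t. Qed.

Let N_le g c : (forall t, `|g t| <= c) -> N g <= c.
Proof.
move=> gc; apply: ge_sup; first by exists `|g t0|, t0.
by move=> _ [t _ <-]; exact: gc.
Qed.

Let Phi_ge0 g : Gamma g -> 0 <= Phi g.
Proof. by move=> Gg; exact: le_trans (F_ge0 _) (Phi_ge t0 Gg). Qed.

Let N_ge0 g : Gamma g -> 0 <= N g.
Proof. by move=> Gg; exact: le_trans (normr_ge0 _) (N_ge t0 Gg). Qed.

Let h1 r : 0 <= r -> 0 < 1 + h r.
Proof. by move=> r0; have [_ _ h0 _] := h_adm; rewrite ltr_pwDl// h0. Qed.

Let N_dist g g' e : Gamma g -> (forall t, `|g' t - g t| <= e) -> N g' <= N g + e.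
Proof.
move=> Gg gg'; apply: N_le => t; have := N_ge t Gg; have := gg' t.
by have := ler_normD (g' t - g t) (g t); rewrite subrK; lra.
Qed.

(* The relation below is not transitive, so no minimal element is available;
   continuity of [h] along the limit of a greedy sequence replaces it. *)
Lemma weighted_ekeland (sigma : R) (g0 : T -> X) : 0 < sigma -> Gamma g0 ->
  exists g, [/\ Gamma g, forall t, F (g t) <= Phi g0 &
    forall (k t : R) g', sigma / (1 + h (N g)) < k -> 0 < t -> Gamma g' ->
      (forall s, `|g' s - g s| <= t) ->
      ~ (forall s, F (g' s) <= Phi g - k * t)].
Proof.
move=> s0 Gg0.
pose k g := sigma / (1 + h (N g)).
have k0 g : Gamma g -> 0 < k g by move=> Gg; rewrite divr_gt0// h1// N_ge0.
(* Moves whose length is paid for by the decrease of [Phi], at the rate [k g] of the starting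
   map. *)
pose S g g' := Gamma g' /\ forall s, `|g' s - g s| * k g <= Phi g - Phi g'.
(* The greedy choice: the next map achieves at least half of the decrease available to any
   admissible move. *)
have /choice[nxt hnxt] : forall g, exists g', Gamma g ->
    S g g' /\ forall g'', S g g'' -> 2 * Phi g' <= Phi g + Phi g''.
  move=> g; have [Gg|nG] := pselect (Gamma g); last by exists g.
  have Sgg : S g g by split=> // s; rewrite subrr normr0 mul0r subrr.
  pose A := [set Phi g' | g' in S g].
  have lA : lbound A 0 by move=> _ [g' [Gg' _] <-]; exact: Phi_ge0.
  have hA : has_inf A by split; [exists (Phi g), g|exists 0].
  have Aub g' : S g g' -> inf A <= Phi g'.
    by move=> Sg'; apply: ge_inf; [exists 0|exists g'].
  have := Aub g Sgg; rewrite le_eqVlt => /orP[/eqP E|Ig].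
    by exists g => _; split => // g'' /Aub; rewrite E; lra.
  have e0 : 0 < (Phi g - inf A) / 2 by lra.
  have [_ [g' Sg' <-] g'I] := inf_adherent e0 hA.
  by exists g' => _; split => // g'' /Aub; lra.
pose u n := iter n nxt g0.
have Gu n : Gamma (u n) by elim: n => // n ih; exact: (hnxt _ ih).1.1.
have Su n : S (u n) (u n.+1) := (hnxt _ (Gu n)).1.
have umin n g'' : S (u n) g'' -> 2 * Phi (u n.+1) <= Phi (u n) + Phi g''.
  exact: (hnxt _ (Gu n)).2.
pose b n := Phi (u n).
have bS n : b n.+1 <= b n.
  rewrite -subr_ge0; apply: le_trans ((Su n).2 t0).
  by rewrite mulr_ge0// ltW// k0.
have bmono m n : (m <= n)%N -> b n <= b m.
  move=> mn; rewrite -(subnKC mn); elim: (n - m)%N => [|j ih]; first by rewrite addn0.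
  by rewrite addnS; exact: le_trans (bS _) ih.
have step n s : `|u n.+1 s - u n s| <= (b n - b n.+1) / sigma * (1 + h (N (u n))).
  have := (Su n).2 s; rewrite -ler_pdivlMr ?k0// /k.
  by rewrite invf_div mulrA mulrAC.
(* The sup norms grow exactly as in the recursion controlled by divergence of the integral. *)
have [B hB] : exists B, forall n, N (u n) <= B.
  apply: (@weighted_steps_bounded _ _ h_adm (N \o u) (fun n => b n / sigma) 0) => /=.
  - by move=> n; exact: N_ge0.
  - by move=> n; rewrite ler_pM2r// invr_gt0.
  - by move=> n; rewrite divr_ge0 ?Phi_ge0// ltW.
  - by move=> n; apply: N_dist => // s; rewrite -mulrBl; exact: step.
have B0 : 0 <= B := le_trans (N_ge0 (Gu 0%N)) (hB 0%N).
(* Along a bounded sequence the weights are at most [1 + h B], so [K * b n] telescopes the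
   increments uniformly in the parameter. *)
pose K := (1 + h B) / sigma.
have K0 : 0 < K by rewrite divr_gt0// h1.
have hbinf : has_inf (range b).
  by split; [exists (b 0%N), 0%N|exists 0 => _ [n _ <-]; exact: Phi_ge0].
pose l := inf (range b).
have lb n : l <= b n by apply: ge_inf; [case: hbinf|exists n].
have bl e : 0 < e -> exists n, forall m, (n <= m)%N -> b m < l + e.
  move=> e0; have [_ [n _ <-] bn] := inf_adherent e0 hbinf.
  by exists n => m nm; exact: le_lt_trans (bmono _ _ nm) bn.
have /choice[g hg] : forall s, exists x, (u n s @[n --> \oo] --> x) /\
    forall n, `|x - u n s| <= K * b n - K * l.
  move=> s; have [||x ux xb] :=
    @cvg_telescope R X (fun n => u n s) (fun n => K * b n) (K * l).
  - move=> n; apply: le_trans (step n s) _.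
    have -> : K * b n - K * b n.+1 = (b n - b n.+1) / sigma * (1 + h B).
      by rewrite /K; ring.
    rewrite ler_wpM2l ?divr_ge0 ?subr_ge0 ?(ltW s0)// lerD2l.
    have [_ hmono _ _] := h_adm.
    by apply: hmono; rewrite ?in_itv/= ?andbT ?N_ge0.
  - by move=> n; rewrite ler_pM2l.
  by exists x.
have Kbl e : 0 < e -> exists n, forall m, (n <= m)%N -> K * b m - K * l < e.
  move=> e0; have [|n hn] := bl (e / K); first by rewrite divr_gt0.
  exists n => m nm; rewrite -mulrBr -ltr_pdivlMl// mulrC; have := hn m nm; lra.
have Gg : Gamma g.
  apply: (Gamma_closed Gu) => e e0; have [n hn] := Kbl e e0.
  by exists n => t; apply: le_lt_trans ((hg t).2 n) (hn n _).
have gb n s : F (g s) <= b n.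
  have Fu : F (u m s) @[m --> \oo] --> F (g s).
    by apply: continuous_cvg; [exact: F_cont|exact: (hg s).1].
  rewrite -(cvg_lim _ Fu)//; apply: limr_le; first exact: cvgP Fu.
  by exists n => // m /= nm; exact: le_trans (Phi_ge s (Gu m)) (bmono _ _ nm).
exists g; split=> // [t|k' t g' kk' tp Gg' g'g g'F]; first exact: (gb 0%N).
have Pg n : Phi g <= b n by apply: Phi_le => s; exact: gb.
have Pgl : Phi g <= l by apply: lb_le_inf; [case: hbinf|move=> _ [n _ <-]].
have Pg' : Phi g' <= Phi g - k' * t by exact: Phi_le.
have hNg := h1 (N_ge0 Gg).
have k'0 : 0 < k' by apply: lt_trans kk'; rewrite divr_gt0.
move: kk'; rewrite ltr_pdivrMr// => gap.
(* The gap left by the strict inequality on [k']. Half of it absorbs the change of [h] from [N g] to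
   [N (u n)], the other half the distance [de] from [g] to [u n]; hence [g'] is an admissible move
   from [u n]. *)
pose D := k' * (1 + h (N g)) - sigma.
have D0 : 0 < D by rewrite subr_gt0.
have [|d d0 hd] := @weight_continuous _ _ (N g) (D / (2 * k')) h_adm (N_ge0 Gg).
  by rewrite divr_gt0// mulr_gt0.
have kt0 : 0 < k' * t by rewrite mulr_gt0.
have dd0 : 0 < Num.min d (t * D / (2 * sigma)).
  by rewrite lt_min d0 divr_gt0// mulr_gt0.
have [n1 hn1] := Kbl _ dd0.
have [n2 hn2] := bl _ kt0.
pose n := maxn n1 n2.
have := hn1 n (leq_maxl _ _); rewrite lt_min; set de := K * b n - K * l => /andP[ded deD].
have bn := hn2 n (leq_maxr _ _).
have ug s : `|g s - u n s| <= de by exact: (hg s).2.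
have Ndist : `|N g - N (u n)| < d.
  apply: le_lt_trans ded; rewrite ler_distl; apply/andP; split.
    by rewrite lerBlDr; apply: N_dist => // s; rewrite distrC.
  exact: N_dist.
have hh := hd _ (N_ge0 (Gu n)) Ndist.
have Sg' : S (u n) g'.
  split=> // s; apply: (@le_trans _ _ (k' * t)); last by have := Pg n; rewrite /b; lra.
  rewrite /k mulrA ler_pdivrMr ?h1 ?N_ge0//.
  have : `|g' s - u n s| <= t + de.
    have := g'g s; have := ug s.
    by have := ler_normD (g' s - g s) (g s - u n s); rewrite addrA subrK; lra.
  rewrite -(ler_pM2r s0) => /le_trans; apply.
  move: hh; rewrite ltr_distl => /andP[_ hh].
  have : k' * (h (N g)) <= k' * h (N (u n)) + D / 2.
    have -> : D / 2 = k' * (D / (2 * k')) by field; rewrite gt_eqF.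
    by rewrite -mulrDr ler_pM2l// ltW.
  move: deD; rewrite ltr_pdivlMr ?mulr_gt0// => deD.
  move=> khh; have : t * (k' * h (N g)) <= t * (k' * h (N (u n)) + D / 2).
    by rewrite ler_pM2l.
  rewrite /D; move: deD; rewrite /D; lra.
(* [Phi g' <= l - k' * t] and [b n < l + k' * t], so the greedy choice would put [b n.+1] below the
   infimum [l]. *)
have := umin n g' Sg'; have := lb n.+1; rewrite -/(b n) -/(b n.+1); lra.
Qed.
End Ekeland.

(** * Deformation *)

Section Deformation.
Variables (R : realType) (X : completeNormedModType R) (F : X -> R).
Hypothesis F_cont : continuous F.

Lemma compact_gt0_lower_bound (A : set X) (p : X -> R) :
  compact A -> continuous p -> (forall x, A x -> 0 < p x) ->
  exists2 m : R, 0 < m & forall x, A x -> m <= p x.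
Proof.
move=> cA cp p0.
have /compact_closed cpA : compact (p @` A).
  by apply: continuous_compact => //; exact: continuous_subspaceT.
have /nbhs_ballP[m /= m0 hm] : nbhs (0 : R) (~` (p @` A)).
  apply: open_nbhs_nbhs; split.
    by apply: closed_openC; apply: cpA; exact: Rhausdorff.
  by move=> [x Ax px0]; have := p0 x Ax; rewrite px0 ltxx.
exists m => // x Ax; rewrite leNgt; apply/negP => pm.
apply: (hm (p x)); last by exists x.
by rewrite -ball_normE/= sub0r normrN gtr0_norm// p0.
Qed.

Lemma seq_gt0_lower_bound (s : seq X) (p : X -> R) :
  (forall x, x \in s -> 0 < p x) ->
  exists2 m : R, 0 < m & forall x, x \in s -> m <= p x.
Proof.
elim: s => [|a s ih] hp; first by exists 1.
have [|m m0 hm] := ih; first by move=> x xs; apply: hp; rewrite inE xs orbT.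
exists (Num.min (p a) m); first by rewrite lt_min m0 hp// mem_head.
move=> x; rewrite inE => /orP[/eqP ->|/hm]; rewrite ge_min ?lexx// => ->.
by rewrite orbT.
Qed.

Lemma continuous_sum_seq (W : normedModType R) (s : seq X) (p : X -> X -> W) :
  (forall a, continuous (p a)) -> continuous (fun x => \sum_(a <- s) p a x).
Proof.
move=> cp; elim: s => [|a s ih].
  have -> : (fun x => \sum_(a <- [::]) p a x) = cst 0.
    by apply/funext => x; rewrite big_nil.
  by move=> x; exact: cvg_cst.
have -> : (fun x => \sum_(b <- a :: s) p b x) =
    (fun x => p a x + \sum_(b <- s) p b x).
  by apply/funext => x; rewrite big_cons.
by move=> x; apply: cvgD; [exact: cp|exact: ih].
Qed.

(* The points with [F x = c] descend along finitely many directions glued by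
   cone-shaped weights. Adding [c - F x] to the normalisation keeps it positive
   on [A]; at points below the level this costs exactly the margin available. *)
Lemma deformation (A : set X) (c c' k : R) :
  compact A -> (forall x, A x -> F x <= c) -> c' < c -> 0 < k ->
  (forall x, A x -> F x = c -> exists2 v, `|v| <= 1 & slope_le F x v (- k)) ->
  exists eta : X -> X, exists2 t : R, 0 < t &
    [/\ continuous eta, forall x, F x <= c' -> eta x = x,
        forall x, A x -> `|eta x - x| <= t &
        forall x, A x -> F (eta x) <= c - k * t].
Proof.
move=> cA Ac cc k0 Av.
pose M := A `&` [set x | F x = c].
have cM : compact M.
  apply: compact_closedI => //.
  by apply: (@closed_comp _ _ F [set c]); [move=> x _; exact: F_cont|exact: closed_eq].
(* The radius also keeps [F] above [c'] on the ball, so that the deformation fixes every point at or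
   below that level. *)
have /choice[v /choice[d hvd]] : forall x, exists v, exists d : R, M x ->
    [/\ `|v| <= 1, 0 < d, forall z, `|z - x| < d -> c' < F z &
      forall z (t : R), `|z - x| < d -> 0 < t -> t < d ->
        F (z + t *: v) - F z <= - k * t].
  move=> x; have [[Ax Fx]|nM] := pselect (M x); last by exists 0, 0.
  have [v v1 [d d0 hd]] := Av x Ax Fx.
  have cc0 : 0 < c - c' by rewrite subr_gt0.
  have /nbhs_ballP[e /= e0 he] : nbhs x (fun z => `|F x - F z| < c - c').
    by move/cvgrPdist_lt: (@F_cont x); exact.
  exists v, (Num.min d e) => _; split => //; first by rewrite lt_min d0.
    move=> z; rewrite lt_min => /andP[_ ze].
    have := he z; rewrite -ball_normE/= distrC => /(_ ze).
    by rewrite Fx ltr_distlC => /andP[+ _]; lra.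
  by move=> z t; rewrite !lt_min => /andP[zd _] t0 /andP[td _]; exact: hd.
have : cover_compact M by rewrite -compact_cover.
move=> /(_ X M (fun x => ball x (d x / 2))) [|x Mx|D DM MD].
- by move=> x /hvd[_ d0 _ _]; apply: ball_open; rewrite divr_gt0.
- by exists x => //; apply: ballxx; have [_ d0 _ _] := hvd _ Mx; rewrite divr_gt0.
pose s : seq X := finmap.enum_fset D.
have sM x : x \in s -> M x by move=> xs; have := DM x xs; rewrite inE.
(* Cones supported in the half balls; the other half of each ball is room for the displacement, of
   length at most [t <= d a / 2]. *)
pose psi (a x : X) : R := Num.max 0 (d a / 2 - `|x - a|).
have psi0 a x : 0 <= psi a x by rewrite /psi le_max lexx.
have maxc (p q : X -> R) : continuous p -> continuous q ->
    continuous (fun x => Num.max (p x) (q x)).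
  by move=> cp cq x; exact: (continuous_max (cp x) (cq x)).
have psic a : continuous (psi a).
  apply: maxc => x; first exact: cvg_cst.
  apply: cvgB; first exact: cvg_cst.
  by apply: cvg_norm; apply: cvgB; [exact: cvg_id|exact: cvg_cst].
pose S x := \sum_(a <- s) psi a x.
have S0 x : 0 <= S x by apply: sumr_ge0.
pose P x := S x + (c - F x).
have Pc : continuous P.
  move=> x; apply: cvgD; first exact: (@continuous_sum_seq R^o).
  by apply: cvgB; [exact: cvg_cst|exact: F_cont].
have P0 x : A x -> 0 < P x.
  move=> Ax; have [Fc|Fc] := eqVneq (F x) c; last first.
    by rewrite ltr_wpDl// subr_gt0 lt_neqAle Fc Ac.
  rewrite /P Fc subrr addr0; have [a /= aD] := MD x (conj Ax Fc).
  rewrite -ball_normE/= distrC => xa.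
  rewrite /S (perm_big _ (perm_to_rem (aD : a \in s)))/= big_cons ltr_pwDl//.
    by rewrite /psi lt_max subr_gt0 xa orbT.
  exact: sumr_ge0.
have [m m0 Pm] := compact_gt0_lower_bound cA Pc P0.
have [e e0 he] : exists2 e : R, 0 < e & forall a, a \in s -> e <= d a / 2.
  apply: seq_gt0_lower_bound => a /sM /hvd[_ d0 _ _]; by rewrite divr_gt0.
(* [e] keeps displaced points where their directions still descend; [k * t <= m <= P x] bounds the
   loss from the added term [c - F x]. *)
pose t := Num.min e (m / k).
have t0 : 0 < t by rewrite lt_min e0 divr_gt0.
have te : t <= e by rewrite ge_min lexx.
have tm : k * t <= m by rewrite mulrC -ler_pdivlMr// ge_min lexx orbT.
(* Agrees with [P] on [A] and is positive everywhere, so the weights are continuous on all of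
   [X]. *)
pose Q x := Num.max (P x) m.
have Q0 x : 0 < Q x by rewrite lt_max m0 orbT.
have QP x : A x -> Q x = P x by move=> Ax; apply/max_idPl; exact: Pm.
pose w a x := psi a x / Q x.
have w0 a x : 0 <= w a x by rewrite divr_ge0// ltW.
exists (fun x => x + t *: \sum_(a <- s) w a x *: v a), t => //.
have sumw x (r : seq X) : `|\sum_(a <- r) w a x *: v a| <= \sum_(a <- r) w a x * `|v a|.
  apply: le_trans (ler_norm_sum _ _ _) _; apply: ler_sum => a _.
  by rewrite normrZ ger0_norm.
have sumw1 x (r : seq X) : {subset r <= s} ->
    `|\sum_(a <- r) w a x *: v a| <= \sum_(a <- r) w a x.
  move=> rs; apply: le_trans (sumw _ _) _.
  rewrite big_seq [leRHS]big_seq; apply: ler_sum => a ar.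
  have [v1 _ _ _] := hvd a (sM _ (rs _ ar)).
  by rewrite -[leRHS]mulr1 ler_wpM2l.
have sumE x : \sum_(a <- s) w a x = S x / Q x by rewrite /S mulr_suml.
have sumle x : A x -> \sum_(a <- s) w a x <= 1.
  move=> Ax; rewrite sumE ler_pdivrMr// mul1r QP// /P lerDl subr_ge0.
  exact: Ac.
(* The directions are applied one after another: each partial displacement has length at most [t],
   so the slope bound of the next direction holds at the point reached. *)
have descent x (r : seq X) : {subset r <= s} -> \sum_(a <- r) w a x <= 1 ->
    F (x + t *: \sum_(a <- r) w a x *: v a) <= F x - k * t * \sum_(a <- r) w a x.
  elim: r => [|a r ih] rs; first by rewrite !big_nil scaler0 addr0 mulr0 subr0.
  rewrite !big_cons => sr.
  have rs' : {subset r <= s} by move=> b br; apply: rs; rewrite inE br orbT.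
  have sr1 : \sum_(a0 <- r) w a0 x <= 1 by have := w0 a x; lra.
  have := ih rs' sr1; set z := x + t *: _ => Fz.
  have -> : x + t *: (w a x *: v a + \sum_(j <- r) w j x *: v j) =
      z + (t * w a x) *: v a.
    by rewrite /z scalerDr scalerA addrA addrAC.
  have := w0 a x; rewrite le_eqVlt => /orP[/eqP wa|wa].
    by rewrite -wa mulr0 scale0r addr0 add0r.
  have psia : 0 < psi a x.
    by move: wa; rewrite /w pmulr_lgt0// invr_gt0.
  have xa : `|x - a| < d a / 2 by move: psia; rewrite /psi lt_max ltxx/= subr_gt0.
  have as_ : a \in s by apply: rs; rewrite mem_head.
  have [_ da0 _ hd] := hvd a (sM _ as_).
  have ea := he a as_.
  have wa1 : w a x <= 1.
    apply: le_trans sr; rewrite lerDl; exact: sumr_ge0.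
  have h1 : F (z + (t * w a x) *: v a) - F z <= - k * (t * w a x).
    apply: hd.
    - rewrite /z addrAC; apply: le_lt_trans (ler_normD _ _) _.
      rewrite normrZ gtr0_norm//; have := sumw1 x r rs' => h.
      have : t * `|\sum_(j <- r) w j x *: v j| <= t * 1.
        by rewrite ler_pM2l//; exact: le_trans sr1.
      lra.
    - by rewrite mulr_gt0.
    - have : t * w a x <= t * 1 by rewrite ler_pM2l.
      lra.
  lra.
split.
- move=> x; apply: cvgD; first exact: cvg_id.
  apply: cvgZ; first exact: cvg_cst.
  apply: (@continuous_sum_seq X s (fun a x => w a x *: v a)) => a z.
  apply: cvgZ; last exact: cvg_cst.
  apply: cvgM; first exact: psic.
  apply: cvgV; first by rewrite gt_eqF.
  by apply: maxc; [exact: Pc|move=> ?; exact: cvg_cst].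
- move=> x Fx; rewrite big_seq big1 ?scaler0 ?addr0// => a as_.
  suff -> : w a x = 0 by rewrite scale0r.
  rewrite /w (_ : psi a x = 0) ?mul0r//; apply/max_idPl.
  rewrite subr_le0 leNgt; apply/negP => xa.
  have [_ d0 hF _] := hvd a (sM _ as_).
  have : c' < F x by apply: hF; lra.
  by rewrite ltNge Fx.
- move=> x Ax; rewrite addrAC subrr add0r normrZ gtr0_norm//.
  rewrite -[leRHS]mulr1 ler_pM2l//; apply: le_trans (sumw1 _ _ _) (sumle _ Ax).
  by [].
- move=> x Ax; apply: le_trans (descent x s _ (sumle x Ax)) _ => //.
  rewrite sumE QP//.
  have PP := P0 x Ax; have PM := Pm x Ax.
  have -> : S x / P x = 1 - (c - F x) / P x by rewrite /P; field; rewrite gt_eqF.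
  have Fc : 0 <= c - F x by rewrite subr_ge0 Ac.
  have : k * t * ((c - F x) / P x) <= c - F x.
    rewrite mulrA ler_pdivrMr// mulrC ler_wpM2l//; exact: le_trans tm PM.
  lra.
Qed.
End Deformation.

(** * Minimax *)

(** If every maximum point of [F] along the Ekeland map had a steep descent direction, the
    deformation would move the map by at most [t] and lower its supremum by [k * t], which Ekeland's
    principle forbids. *)
Lemma minimax_almost_critical (R : realType) (X : completeNormedModType R)
    (F : X -> R) (T : Type) (t0 : T) (Gamma : set (T -> X)) (h : R -> R)
    (c' sigma : R) (g0 : T -> X) :
  continuous F -> (forall x, 0 <= F x) -> admissible_weight h ->
  (forall g, Gamma g -> compact (range g)) ->
  (forall (u : nat -> T -> X) (g : T -> X), (forall n, Gamma (u n)) ->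
    (forall e : R, 0 < e -> exists n, forall t, `|g t - u n t| < e) ->
    Gamma g) ->
  (forall g eta, Gamma g -> continuous eta ->
    (forall x, F x <= c' -> eta x = x) -> Gamma (eta \o g)) ->
  (forall g, Gamma g -> exists t, c' < F (g t)) ->
  0 < sigma -> Gamma g0 ->
  exists x, [/\ (exists2 g, Gamma g & forall t, F (g t) <= F x),
    F x <= sup (range (F \o g0)) &
    forall v a, slope_le F x v a -> - (sigma / (1 + h `|x|) * `|v|) <= a].
Proof.
move=> Fc F0 hadm Gcpt Gcl Geta Gc s0 Gg0.
have Gb g : Gamma g -> has_ubound (range (F \o g)) /\
    has_ubound (range (fun t => `|g t|)).
  move=> /Gcpt cg; split.
    have /compact_bounded[M [_ hM]] : compact (F @` range g).
      by apply: continuous_compact => //; exact: continuous_subspaceT.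
    exists (M + 1) => _ [t _ <-].
    apply: le_trans (ler_norm _) _; apply: (hM (M + 1)); first by rewrite ltrDl.
    by exists (g t) => //; exists t.
  have [M [_ hM]] := compact_bounded cg.
  exists (M + 1) => _ [t _ <-]; apply: (hM (M + 1)); first by rewrite ltrDl.
  by exists t.
(* Ekeland excludes only rates strictly above its own; halving [sigma] there makes the rate [k]
   below admissible. *)
have s2 : 0 < sigma / 2 by rewrite divr_gt0.
have [g [Gg gg0 gmin]] := weighted_ekeland t0 Fc F0 hadm Gb Gcl s2 Gg0.
set N := sup (range (fun t => `|g t|)) in gmin.
set c := sup (range (F \o g)) in gmin.
have gc t : F (g t) <= c by apply: ub_le_sup; [case: (Gb g Gg)|exists t].
have gN t : `|g t| <= N by apply: ub_le_sup; [case: (Gb g Gg)|exists t].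
have N0 : 0 <= N by exact: le_trans (normr_ge0 _) (gN t0).
have [_ hmono h0 _] := hadm.
have h1 r : 0 <= r -> 0 < 1 + h r by move=> r0; rewrite ltr_pwDl// h0.
pose k := sigma / (1 + h N).
have k0 : 0 < k by rewrite divr_gt0// h1.
apply: contrapT => /forallNP hx.
have [||x [t _ <-] Fx|eta [t tp [etac etaZ etad etaF]]] :=
    @deformation R X F Fc (range g) c c' k (Gcpt _ Gg) _ _ k0.
- by move=> _ [t _ <-]; exact: gc.
- by have [t ct] := Gc g Gg; exact: lt_le_trans ct (gc t).
- apply: contrapT => nv; apply: (hx (g t)); split.
  + by exists g => // s; rewrite Fx.
  + exact: gg0.
  move=> v a va; rewrite leNgt; apply/negP => av; apply: nv.
  have kx : k <= sigma / (1 + h `|g t|).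
    rewrite ler_pM2l// lef_pV2 ?posrE ?h1// lerD2l.
    by apply: hmono; rewrite ?in_itv/= ?andbT.
  have a0 : a < - (k * `|v|).
    apply: lt_le_trans av _; rewrite lerN2; exact: ler_wpM2r.
  (* In the direction [0] all increments vanish, so no slope there is negative; hence [v] can be
     normalized. *)
  have v0 : 0 < `|v|.
    rewrite lt_neqAle normr_ge0 andbT eq_sym normr_eq0; apply/eqP => v0.
    move: va a0 => [d d0 hd]; rewrite v0 normr0 mulr0 oppr0 => a0.
    have := hd (g t) (d / 2); rewrite v0 scaler0 addr0 !subrr normr0.
    have d2 : 0 < d / 2 by rewrite divr_gt0.
    have d2d : d / 2 < d by lra.
    move=> /(_ d0 d2 d2d); rewrite pmulr_lge0//; lra.
  exists (`|v|^-1 *: v).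
    by rewrite normrZ gtr0_norm ?invr_gt0// mulVf// gt_eqF.
  have vi : 0 < `|v|^-1 by rewrite invr_gt0.
  have [d d0 hd] := slope_leZ vi va.
  exists d => // z s zd sp sd; apply: le_trans (hd z s zd sp sd) _.
  by rewrite ler_pM2r// mulrC ler_pdivrMr// mulNr ltW.
- apply: (gmin k t (eta \o g)) => //.
  + by rewrite /k ltr_pM2r ?invr_gt0 ?h1//; lra.
  + exact: Geta.
  + by move=> s; apply: etad; exists s.
  + by move=> s; apply: etaF; exists s.
Qed.

(** The slope bounds make the weighted [clarke_lambda] at most [1 / n.+1], so a subsequence
    converges. At a limit with [f x != y] a direction of slope [- c] would work at all nearby
    points, against the vanishing bounds. *)
Lemma chang_PS_limit (R : realType) (X : normedModType R)
    (Y : normedModType R) (f : X -> Y) (y : Y) (h : R -> R) (u : nat -> X)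
    (C : R) : local_C1_diffeo f -> admissible_weight h ->
  weighted_chang_PS (dist_functional f y) h ->
  (forall n, dist_functional f y (u n) <= C) ->
  (forall n v a, slope_le (dist_functional f y) (u n) v a ->
     - (n.+1%:R^-1 / (1 + h `|u n|) * `|v|) <= a) ->
  exists phi : nat -> nat, exists2 x, u \o phi @ \oo --> x & f x = y.
Proof.
move=> [f1 fbij] [_ _ h0 _] hPS uC us.
have h1 r : 0 <= r -> 0 < 1 + h r by move=> r0; rewrite ltr_pwDl// h0.
have [||phi phi_inc cu] := hPS u.
- exists C; split=> [|M CM n _ /=]; first exact: num_real.
  rewrite ger0_norm; first exact: le_trans (uC n) (ltW CM).
  by rewrite mulr_ge0// exprn_ge0.
- apply: (@squeeze_cvgr _ _ _ _ (cst 0) harmonic); last 2 first.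
  + exact: cvg_cst.
  + exact: cvg_harmonic.
  apply: nearW => n; rewrite mulr_ge0 ?clarke_lambda_ge0 ?(ltW (h1 _ _))//=.
  rewrite -ler_pdivlMr ?h1//; apply: clarke_lambda_le.
  + by rewrite divr_ge0 ?invr_ge0// ltW// h1.
  + exact: dist_functional_lipschitz_at.
  + exact: us.
have phi_ge n : (n <= phi n)%N.
  elim: n => // n ih; apply: leq_ltn_trans ih _.
  by have := phi_inc n.+1 n; rewrite !leEnat ltnn ltnNge => ->.
exists phi, (limn (u \o phi)) => //; set x := limn _ in cu *.
apply/eqP; apply: contrapT => /negP fxy.
have [|v [c [d [c0 d0 hd]]]] := dist_functional_slope f1 _ fxy.
  by have [g _ gK] := fbij x; exists (g (y - f x)).
have [n0 _ hn0] := iffLR (cvgrPdist_lt _ _) cu d d0.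
(* Far enough for [u (phi n)] to be near [x] and, since [n <= phi n], for the norm of [v] divided by
   [(phi n).+1] to be below [c]. *)
pose n := maxn n0 (Num.bound (`|v| / c)).
have nv : `|v| / c < n%:R.
  apply: lt_le_trans (archi_boundP _) _; first by rewrite divr_ge0// ltW.
  by rewrite ler_nat leq_maxr.
have un : `|u (phi n) - x| < d.
  by rewrite distrC; apply: (hn0 n); rewrite /= leq_maxl.
have := us _ _ _ (hd _ un); rewrite lerN2.
apply/negP; rewrite -ltNge.
apply: (@le_lt_trans _ _ ((phi n).+1%:R^-1 * `|v|)).
  rewrite ler_wpM2r// ler_pdivrMr ?h1// ler_peMr ?invr_ge0// lerDl h0//.
rewrite ltr_pdivrMl//; apply: (@lt_le_trans _ _ (n%:R * c)).
  by rewrite -ltr_pdivrMr.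
by rewrite ler_pM2r// ler_nat (leq_trans (phi_ge n)).
Qed.

(** * Existence and uniqueness of the solution *)

Section Theorem2.
Variables (R : realType) (X Y : completeNormedModType R) (f : X -> Y) (y : Y).
Hypothesis f_diffeo : local_C1_diffeo f.
Variable h : R -> R.
Hypothesis h_adm : admissible_weight h.
Hypothesis hPS : weighted_chang_PS (dist_functional f y) h.
Let F := dist_functional f y.

Let F_cont : continuous F.
Proof. by apply: dist_functional_continuous; case: f_diffeo. Qed.

Let F_ge0 x : 0 <= F x. Proof. by rewrite mulr_ge0// exprn_ge0. Qed.

Let F_zero x : f x = y -> F x = 0.
Proof. by move=> e; rewrite /F /dist_functional e subrr normr0 expr0n mulr0. Qed.

(** Almost critical points for [sigma = 1 / n.+1] converge along a subsequence to a solution. Each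
    maximizes [F] along some member of [Gamma], so has level at least [b], and continuity passes
    this to the limit. *)
Lemma minimax_solution (T : Type) (t0 : T) (Gamma : set (T -> X)) (c' b : R)
    (g0 : T -> X) :
  (forall g, Gamma g -> compact (range g)) ->
  (forall (u : nat -> T -> X) (g : T -> X), (forall n, Gamma (u n)) ->
    (forall e : R, 0 < e -> exists n, forall t, `|g t - u n t| < e) ->
    Gamma g) ->
  (forall g eta, Gamma g -> continuous eta ->
    (forall x, F x <= c' -> eta x = x) -> Gamma (eta \o g)) ->
  (forall g, Gamma g -> exists2 t, c' < F (g t) & b <= F (g t)) ->
  Gamma g0 -> exists2 x, f x = y & b <= F x.
Proof.
move=> Gcpt Gcl Geta Gc Gg0.
have Gc' g : Gamma g -> exists t, c' < F (g t).
  by move=> /Gc[t ct _]; exists t.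
have n0 (n : nat) : 0 < n.+1%:R^-1 :> R by rewrite invr_gt0.
have /choice[u hu] := fun n => minimax_almost_critical t0 F_cont F_ge0 h_adm
  Gcpt Gcl Geta Gc' (n0 n) Gg0.
have ub n : b <= F (u n).
  have [[g Gg gu] _ _] := hu n; have [t _ bt] := Gc g Gg.
  exact: le_trans bt (gu t).
have [||phi [x ux fx]] := @chang_PS_limit R X Y f y h u
    (sup (range (F \o g0))) f_diffeo h_adm hPS.
- by move=> n; have [] := hu n.
- by move=> n; have [] := hu n.
exists x => //.
have Fu : (F \o u \o phi) n @[n --> \oo] --> F x.
  by apply: continuous_cvg; [exact: F_cont|exact: ux].
rewrite -(cvg_lim _ Fu)//; apply: limr_ge; first exact: cvgP Fu.
by apply: nearW => n; exact: ub.
Qed.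


Lemma solution_exists : exists x, f x = y.
Proof.
(* Maps from a point are points of [X], and the minimax is the minimization of [F]. The level [-1]
   lies below all values of [F], so the deformation has no points to fix. *)
have [|||||x fx _] := @minimax_solution unit tt setT (-1) 0 (fun=> 0) => //.
- move=> g _; have -> : range g = [set g tt]; last exact: compact_set1.
  by apply/seteqP; split=> [_ [[] _ <-]|_ ->]//; exists tt.
- by move=> g _; exists tt => //; exact: lt_le_trans (F_ge0 _).
by exists x.
Qed.

(** A mountain pass between two zeros of [F]: the minimax over paths joining them would give a
    solution at a level [c > 0], whereas [F] vanishes at solutions. *)
Lemma solution_unique x0 x1 : f x0 = y -> f x1 = y -> x0 = x1.
Proof.
move=> fx0 fx1; apply/eqP; apply: contrapT => /negP x01.
have d0 : 0 < `|x1 - x0| by rewrite normr_gt0 subr_eq0 eq_sym.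
have [r0 r0_0 moat] := dist_functional_moat f_diffeo.1 (f_diffeo.2 x0).
(* Small enough for the lower bound on the sphere around [x0], and for [x1] to lie outside it. *)
pose r := Num.min r0 `|x1 - x0| / 2.
have m0 : 0 < Num.min r0 `|x1 - x0| by rewrite lt_min r0_0.
have rp : 0 < r by rewrite divr_gt0.
have : r < Num.min r0 `|x1 - x0| by rewrite /r; lra.
rewrite lt_min => /andP[rr0 rd].
have [c c0 hc] := moat r rp rr0.
(* Paths are extended by constants to all of [R]. Their endpoints have [F = 0], so deformations
   fixing the level [c' = 0] preserve them. *)
pose Gamma := [set g : R -> X | [/\ continuous g,
  forall t, t <= 0 -> g t = x0 & forall t, 1 <= t -> g t = x1]].
pose g0 (t : R) := x0 + Num.max 0 (Num.min 1 t) *: (x1 - x0).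
have [|||||x fx] := @minimax_solution R 0 Gamma 0 c g0.
- move=> g [gc gl gr].
  have -> : range g = g @` `[0, 1].
    apply/seteqP; split=> [_ [t _ <-]|_ [t _ <-]]; last by exists t.
    have [t0|t0] := leP t 0.
      by exists 0; rewrite ?gl//= in_itv/= lexx ler01.
    have [t1|t1] := leP 1 t; first by exists 1; rewrite ?gr//= in_itv/= lexx ler01.
    by exists t => //=; rewrite in_itv/= !ltW.
  apply: continuous_compact; first exact: continuous_subspaceT.
  exact: segment_compact.
- move=> u g Gu ug.
  have lim t z : (forall n, u n t = z) -> g t = z.
    move=> uz; apply/eqP; rewrite -subr_eq0 -normr_eq0 eq_le normr_ge0 andbT.
    rewrite leNgt; apply/negP => gz; have [n /(_ t)] := ug _ gz.
    by rewrite uz ltxx.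
  split=> [t|t t0|t t1]; last 2 first.
    by apply: lim => n; have [_ + _] := Gu n; apply.
    by apply: lim => n; have [_ _] := Gu n; apply.
  apply/cvgrPdist_lt => e e0.
  have e3 : 0 < e / 3 by rewrite divr_gt0.
  have [n hn] := ug _ e3; have [uc _ _] := Gu n.
  have us' : \forall s \near t, `|u n t - u n s| < e / 3.
    by move/cvgrPdist_lt: (@uc t); exact.
  apply: filterS us' => s us.
  have := hn t; have := hn s; rewrite (distrC (g s)) => h1 h2.
  have := ler_normD (g t - u n t) (u n t - g s); rewrite addrA subrK.
  have := ler_normD (u n t - u n s) (u n s - g s); rewrite addrA subrK.
  lra.
- move=> g eta [gc gl gr] etac etaZ; split=> [t|t t0|t t1] /=.
  + by apply: continuous_comp; [exact: gc|exact: etac].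
  + by rewrite gl// etaZ// F_zero.
  + by rewrite gr// etaZ// F_zero.
- move=> g [gc gl gr].
  pose p (t : R) := `|g t - x0|.
  have pc : {within `[0, 1], continuous p}.
    apply: continuous_subspaceT => t.
    by apply: cvg_norm; apply: cvgB; [exact: gc|exact: cvg_cst].
  (* The distance to [x0] runs from [0] to a value above [r], so the path crosses the sphere. *)
  have [|t _ pt] := IVT ler01 pc (v := r).
    rewrite /p (gl _ (lexx _)) (gr _ (lexx _)) subrr normr0.
    by rewrite ge_min le_max ltW//= (ltW rd) orbT.
  have ct : c <= F (g t) by have := hc (g t) pt; rewrite fx0.
  by exists t => //; exact: lt_le_trans ct.
- split=> [t|t t0|t t1].
  + apply: cvgD; first exact: cvg_cst.
    apply: cvgZ; last exact: cvg_cst.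
    have cmin : {for t, continuous (fun t : R => Num.min 1 t)}.
      by apply: continuous_min; [exact: cvg_cst|exact: cvg_id].
    by apply: continuous_max; [exact: cvg_cst|exact: cmin].
  + by rewrite /g0 (min_idPr _) ?(le_trans t0)// max_l// scale0r addr0.
  + by rewrite /g0 min_l// max_r// scale1r addrC subrK.
- by rewrite (F_zero fx) leNgt c0.
Qed.
End Theorem2.

Theorem theorem2 (R : realType) (X Y : completeNormedModType R) (f : X -> Y)
    (hf : local_C1_diffeo f) (y : Y)
    (hPS : exists h : R -> R,
       admissible_weight h /\ weighted_chang_PS (dist_functional f y) h) :
  exists! x : X, f x = y.
Proof.
have [h [hadm hPS']] := hPS.
have [x fx] := solution_exists hf hadm hPS'.
exists x; split=> // x' fx'.
exact: (@solution_unique R X Y f y hf h hadm hPS').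
Qed.
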